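(* Let $M>0$ and $H\in\mathbb{R}$. The following two statements are equivalent. (i) (Existence and uniqueness for the Dirichlet problem.) For every $(T_0,X_0)$ with $X_0>0$ such that $(T_0,X_0)$ and $(T_0,-X_0)$ lie in the Kruskal extension, there exists a unique SS-CMC hypersurface $\Sigma:(T=F(X),X,\theta,\phi)$, $X\in[-X_0,X_0]$, with constant mean curvature parameter $H$ and with $F(X_0)=F(-X_0)=T_0$. (ii) (Existence of the TSS-CMC foliation.) The family $\{\Sigma_H\}$ of all $T$-axisymmetric SS-CMC hypersurfaces with constant mean curvature parameter $H$ foliates the Kruskal extension, that is, the hypersurfaces of the family cover the whole Kruskal extension and any two distinct hypersurfaces of the family are disjoint.
   Context: The Kruskal extension of the Schwarzschild spacetime of mass $M>0$ is described by coordinates $(T,X,\theta,\phi)$, where $(\theta,\phi)$ are spherical coordinates on $\mathbb{S}^2$ and $(T,X)\in\mathbb{R}^2$ ranges over the set $X^2-T^2>-2M$. The function $r=r(T,X)>0$ is defined implicitly by $(r-2M)e^{r/(2M)}=X^2-T^2$. The metric is $$ds^2=\frac{16M^2e^{-r/(2M)}}{r}\,(-dT^2+dX^2)+r^2\,d\theta^2+r^2\sin^2\theta\,d\phi^2.$$ An SS-CMC (spacelike, spherically symmetric, constant mean curvature) hypersurface with constant mean curvature parameter $H$ is a graph $\Sigma:(T=F(X),X,\theta,\phi)$ contained in the Kruskal extension (so $X^2-F(X)^2>-2M$), with $F$ independent of $\theta,\phi$, satisfying the spacelike condition $1-(F'(X))^2>0$ and the SS-CMC equation $$F''(X)+e^{-\frac{r}{2M}}\left(\frac{6M}{r^2}-\frac1r\right)\bigl(-F(X)+F'(X)X\bigr)\bigl(1-(F'(X))^2\bigr)+\frac{12HM\,e^{-\frac{r}{4M}}}{\sqrt{r}}\bigl(1-(F'(X))^2\bigr)^{\frac32}=0,$$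 where $r=r(F(X),X)$. The hypersurface is $T$-axisymmetric (a TSS-CMC hypersurface) if $F(-X)=F(X)$ for all $X$ in its domain. In (ii), the members of $\{\Sigma_H\}$ are taken to be maximally extended, i.e. $F$ is an even solution defined on its maximal interval of existence (an interval symmetric about $0$). *)

(* Defs.v *)
From Stdlib Require Import Reals Lra Psatz Ensembles ClassicalEpsilon.
Local Open Scope R_scope.

Definition kruskal_region (M T X : R) : Prop := X ^ 2 - T ^ 2 > - (2 * M).

Definition is_area_radius (M T X r : R) : Prop :=
  0 < r /\ (r - 2 * M) * exp (r / (2 * M)) = X ^ 2 - T ^ 2.

(* Meaningful on the Kruskal region only, where [is_area_radius] has exactly
   one solution (see [area_radius_spec] and [area_radius_unique]). *)
Definition area_radius (M T X : R) : R :=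
  epsilon (inhabits 0) (is_area_radius M T X).

Lemma area_radius_exists (M T X : R) :
  0 < M -> kruskal_region M T X -> exists r, is_area_radius M T X r.
Proof.
  unfold kruskal_region, is_area_radius. intros HM.
  generalize (X ^ 2 - T ^ 2). intros c Hc.
  set (g := fun r => (r - 2 * M) * exp (r / (2 * M)) - c).
  assert (g0 : g 0 < 0).
  { unfold g. replace (0 / (2 * M)) with 0 by (field; lra). rewrite exp_0. lra. }
  set (b := 2 * M + Rabs c).
  assert (Ha := Rabs_pos c). assert (Hb := Rle_abs c).
  assert (gb : 0 <= g b).
  { unfold g, b.
    assert (H : 0 <= (2 * M + Rabs c) / (2 * M))
      by (apply Rmult_le_pos; [lra | left; apply Rinv_0_lt_compat; lra]).
    assert (E := exp_ineq1_le ((2 * M + Rabs c) / (2 * M))). nra. }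
  assert (Cg : continuity g) by (unfold g; reg; lra).
  destruct (IVT_cor g 0 b Cg) as [z [[z0 zb] gz]]; [unfold b; lra | nra |].
  exists z. split.
  - destruct (Req_dec z 0) as [-> | n]; lra.
  - unfold g in gz. lra.
Qed.

Lemma area_radius_spec (M T X : R) :
  0 < M -> kruskal_region M T X -> is_area_radius M T X (area_radius M T X).
Proof.
  intros HM HX. unfold area_radius. apply epsilon_spec. now apply area_radius_exists.
Qed.

Lemma area_radius_unique (M T X r : R) :
  0 < M -> is_area_radius M T X r -> r = area_radius M T X.
Proof.
  intros HM Hr.
  assert (Hs : is_area_radius M T X (area_radius M T X))
    by (unfold area_radius; apply epsilon_spec; now exists r).
  assert (mono : forall x y, 0 < x -> x < y ->
            (x - 2 * M) * exp (x / (2 * M)) < (y - 2 * M) * exp (y / (2 * M))).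
  { intros x y Hx Hxy.
    set (u := x / (2 * M)). set (d := (y - x) / (2 * M)).
    assert (Hi : 0 < / (2 * M)) by (apply Rinv_0_lt_compat; lra).
    assert (u0 : 0 < u) by (unfold u, Rdiv; nra).
    assert (d0 : 0 < d) by (unfold d, Rdiv; nra).
    replace (y / (2 * M)) with (u + d) by (unfold u, d; field; lra).
    replace (x - 2 * M) with (2 * M * (u - 1)) by (unfold u; field; lra).
    replace (y - 2 * M) with (2 * M * (u + d - 1)) by (unfold u, d; field; lra).
    rewrite exp_plus. assert (Eu := exp_pos u).
    assert (key : u - 1 < (u + d - 1) * exp d).
    { assert (E1 := exp_ineq1_le d). assert (E2 := exp_ineq1_le (- d)).
      assert (E3 : exp d * exp (- d) = 1)
        by (rewrite <- exp_plus, Rplus_opp_r; apply exp_0).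
      assert (E4 := exp_pos d).
      assert (E5 : (1 - d) * exp d <= 1) by nra.
      destruct (Rle_dec 1 (u + d)); [nra |].
      assert ((1 - u) * (1 - d) * exp d <= 1 - u) by nra.
      assert (0 < u * d * exp d) by (repeat apply Rmult_lt_0_compat; lra).
      nra. }
    assert (0 < 2 * M * exp u) by nra. nra. }
  destruct Hr as [r0 Er], Hs as [s0 Es].
  destruct (Rtotal_order r (area_radius M T X)) as [h | [h | h]]; trivial.
  - assert (h' := mono _ _ r0 h). lra.
  - assert (h' := mono _ _ s0 h). lra.
Qed.

Definition sphere : Type :=
  {n : R * R * R | fst (fst n) ^ 2 + snd (fst n) ^ 2 + snd n ^ 2 = 1}.

(* (T, X, n), where n replaces the angles (theta, phi) *)
Definition event : Type := (R * R * sphere)%type.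

Definition kruskal_extension (M : R) : Ensemble event :=
  fun '(T, X, _) => kruskal_region M T X.

(* Intervals are arbitrary (open, closed, bounded or not), but not reduced to
   a point, so that derivatives relative to them are unique. *)
Definition interval (D : R -> Prop) : Prop :=
  (forall x y z, D x -> D z -> x <= y <= z -> D y) /\
  (exists x y, D x /\ D y /\ x < y).

Definition closed_interval (a b : R) : R -> Prop := fun x => a <= x <= b.

(* Left-hand side of the SS-CMC equation with t = F(x), p = F'(x), q = F''(x). *)
Definition ss_cmc_operator (M H x t p q : R) : R :=
  let r := area_radius M t x in
  q + exp (- (r / (2 * M))) * (6 * M / r ^ 2 - 1 / r) * (- t + p * x)
        * (1 - p ^ 2)
    + 12 * H * M * exp (- (r / (4 * M))) / sqrt r
        * Rpower (1 - p ^ 2) (3 / 2).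

(* Only the values of F on D matter.  Derivatives are relative to D, hence
   one-sided at an endpoint belonging to D; the equation then forces F'' to be
   continuous on D. *)
Definition ss_cmc (M H : R) (D : R -> Prop) (F : R -> R) : Prop :=
  interval D /\
  (forall x, D x -> kruskal_region M (F x) x) /\
  exists F' F'' : R -> R,
    forall x, D x ->
      D_in F F' D x /\ D_in F' F'' D x /\
      1 - F' x ^ 2 > 0 /\
      ss_cmc_operator M H x (F x) (F' x) (F'' x) = 0.

Definition T_axisymmetric (D : R -> Prop) (F : R -> R) : Prop :=
  forall x, D x -> D (- x) /\ F (- x) = F x.

Definition maximally_extended (M H : R) (D : R -> Prop) (F : R -> R) : Prop :=
  forall (D' : R -> Prop) (G : R -> R),
    ss_cmc M H D' G ->
    (forall x, D x -> D' x /\ G x = F x) ->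
    forall x, D' x -> D x.

Definition hypersurface (D : R -> Prop) (F : R -> R) : Ensemble event :=
  fun '(T, X, _) => D X /\ T = F X.

Definition tss_cmc_family (M H : R) (S : Ensemble event) : Prop :=
  exists (D : R -> Prop) (F : R -> R),
    ss_cmc M H D F /\ T_axisymmetric D F /\ maximally_extended M H D F /\
    Same_set event S (hypersurface D F).

Definition foliates (family : Ensemble event -> Prop) (U : Ensemble event)
  : Prop :=
  (forall S, family S -> Included event S U) /\
  (forall e, In event U e -> exists S, family S /\ In event S e) /\
  (forall S1 S2, family S1 -> family S2 ->
     ~ Same_set event S1 S2 -> Disjoint event S1 S2).

(* Main.v *)
Require Import Defs.
From Stdlib Require Import Reals Lra Psatz Ensembles ClassicalEpsilon Classical.
From Coquelicot Require Import Coquelicot.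
Local Open Scope R_scope.

(** The SS-CMC equation is a second-order equation [F'' = acceleration(X, F, F')],
    invariant under [X -> - X]. Its even solutions are those with [F'(0) = 0], so
    the maximal T-axisymmetric hypersurfaces, the leaves, are parametrized by the
    height [c = F(0)] ([tss_cmc_family_iff]). A foliation means that the leaves
    cover the Kruskal region and are pairwise disjoint ([foliates_iff]).

    If the Dirichlet problem is uniquely solvable, then the solution with equal
    boundary heights [T0] at [X0] and [- X0] equals its reflection, hence is part
    of a leaf through [(T0, X0)]; and two leaves that meet at [(T0, X0)] solve the
    same Dirichlet problem and coincide ([dirichlet_imp_foliation]).

    Conversely, let the leaves foliate. The leaf through [(T0, X0)] solves the
    Dirichlet problem. Let [G] be another solution, and follow the index [c] of
    the leaf through [(G(X), X)] as [X] runs through [[- X0, X0]]. It has the same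
    value at both ends, leaves being even, so it has an interior extremum. There
    [G] touches a leaf from one side, hence is tangent to it, hence lies in it by
    uniqueness ([symmetric_boundary_in_leaf]); and only one leaf passes through
    [(T0, X0)]. The extremum exists because the index is continuous
    ([leaf_index_locally]).

    Both directions rest on the behaviour of a leaf at the end of its domain: it
    can only end at the singularity ([leaf_end]). In particular a solution tangent
    to a leaf never leaves it ([tangent_solution_in_leaf]). To see this, the
    equation is truncated to one with a bounded and globally Lipschitz field,
    whose solutions exist on the whole line by Picard iteration
    ([picard_exists]) and are unique ([solves_unique]). The truncation keeps
    [X ^ 2 - T ^ 2] above a level [s0 > - 2 * M]; a spacelike curve that stays
    above that level over a bounded range of [X] solves one equation if and only
    if it solves the other. The slope needs no such care: the null lines solve the
    truncated equation, so by uniqueness [|F'| < 1] persists ([truncated_spacelike]). *)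

(** * Calculus relative to an interval *)

Definition convex (D : R -> Prop) : Prop :=
  forall x y z, D x -> D z -> x <= y <= z -> D y.

Definition clamp (a b x : R) : R := Rmax a (Rmin b x).

Lemma clamp_bounds a b x : a <= b -> a <= clamp a b x <= b.
Proof.
  intros H. unfold clamp, Rmax, Rmin.
  destruct (Rle_dec b x); destruct (Rle_dec a _); lra.
Qed.

Lemma clamp_id a b x : a <= x <= b -> clamp a b x = x.
Proof.
  intros H. unfold clamp, Rmax, Rmin.
  destruct (Rle_dec b x); destruct (Rle_dec a _); lra.
Qed.

Lemma clamp_lipschitz a b x y : Rabs (clamp a b x - clamp a b y) <= Rabs (x - y).
Proof.
  unfold clamp, Rmax, Rmin, Rabs.
  repeat destruct (Rle_dec _ _); repeat destruct (Rcase_abs _); lra.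
Qed.

Lemma continue_in_iff f D x0 :
  continue_in f D x0 <->
  (forall eps, 0 < eps -> exists alp, 0 < alp /\
     forall x, D x -> Rabs (x - x0) < alp -> Rabs (f x - f x0) < eps).
Proof.
  unfold continue_in, limit1_in, limit_in, D_x; simpl; unfold Rdist. split.
  - intros H eps He. destruct (H eps He) as (alp & Ha & K).
    exists alp. split; [lra|]. intros x Dx Hx.
    destruct (Req_dec x x0) as [->|n].
    + rewrite Rminus_diag, Rabs_R0. lra.
    + apply K. repeat split; auto.
  - intros H eps He. destruct (H eps He) as (alp & Ha & K).
    exists alp. split; [lra|]. intros x ((Dx & _) & Hx). auto.
Qed.

Lemma continuity_pt_iff f x0 :
  continuity_pt f x0 <->
  (forall eps, 0 < eps -> exists alp, 0 < alp /\
     forall x, Rabs (x - x0) < alp -> Rabs (f x - f x0) < eps).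
Proof.
  assert (E := continue_in_iff f no_cond x0).
  unfold continuity_pt. rewrite E. split; intros H eps He;
  destruct (H eps He) as (alp & Ha & K); exists alp; split; trivial;
  intros; apply K; try easy; exact I.
Qed.

(** Derivatives relative to a set are local: only the germs of the set and of
    the function matter, and the derivative only at the point itself. *)
Lemma D_in_local f f' d d' (D D' : R -> Prop) x :
  D_in f d D x -> f' x = f x -> d' x = d x ->
  (exists del, 0 < del /\
     forall y, D' y -> Rabs (y - x) < del -> D y /\ f' y = f y) ->
  D_in f' d' D' x.
Proof.
  unfold D_in, limit1_in, limit_in, D_x; simpl; unfold Rdist.
  intros H Ef Ed (del & Hd & L) eps He.
  destruct (H eps He) as (alp & Ha & K).
  exists (Rmin alp del). split; [now apply Rmin_glb_lt|].
  intros y ((Dy & n) & Hy).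
  assert (Hy1 := Rlt_le_trans _ _ _ Hy (Rmin_l _ _)).
  assert (Hy2 := Rlt_le_trans _ _ _ Hy (Rmin_r _ _)).
  destruct (L y Dy Hy2) as (Dy' & ->). rewrite Ef, Ed. auto.
Qed.

Lemma D_in_opp f d (D : R -> Prop) x :
  D_in f d D (- x) ->
  D_in (fun y => f (- y)) (fun y => - d (- y)) (fun y => D (- y)) x.
Proof.
  unfold D_in, limit1_in, limit_in, D_x; simpl; unfold Rdist.
  intros H eps He. destruct (H eps He) as (alp & Ha & K).
  exists alp. split; trivial. intros y ((Dy & n) & Hy).
  replace ((f (- y) - f (- x)) / (y - x) - - d (- x))
    with (- ((f (- y) - f (- x)) / (- y - - x) - d (- x))) by (field; lra).
  rewrite Rabs_Ropp. apply K. repeat split; trivial; try lra.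
  replace (- y - - x) with (- (y - x)) by ring. now rewrite Rabs_Ropp.
Qed.

Lemma clamp_continuous f (D : R -> Prop) a b :
  a <= b -> (forall x, a <= x <= b -> D x /\ continue_in f D x) ->
  continuity (fun x => f (clamp a b x)).
Proof.
  intros Hab H x. apply continuity_pt_iff. intros eps He.
  destruct (H _ (clamp_bounds a b x Hab)) as (_ & C).
  destruct (proj1 (continue_in_iff _ _ _) C eps He) as (alp & Ha & K).
  exists alp. split; trivial. intros y Hy. apply K.
  - apply H, clamp_bounds, Hab.
  - eapply Rle_lt_trans; [apply clamp_lipschitz | exact Hy].
Qed.

Lemma D_in_interior f d (D : R -> Prop) a b x :
  a < x < b -> (forall y, a <= y <= b -> D y) ->
  D_in f d D x -> derivable_pt_lim f x (d x).
Proof.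
  intros Hx HD H. apply derivable_pt_lim_D_in.
  apply (D_in_local _ _ _ _ _ _ _ H); trivial.
  exists (Rmin (x - a) (b - x)). split; [apply Rmin_glb_lt; lra|].
  intros y _ Hy. split; trivial. apply HD.
  assert (Hy1 := Rlt_le_trans _ _ _ Hy (Rmin_l _ _)).
  assert (Hy2 := Rlt_le_trans _ _ _ Hy (Rmin_r _ _)).
  apply Rabs_def2 in Hy1. apply Rabs_def2 in Hy2. lra.
Qed.

(** The mean value theorem with one-sided derivatives at the endpoints. *)
Lemma D_in_mvt f d (D : R -> Prop) a b :
  a <= b -> (forall x, a <= x <= b -> D x /\ D_in f d D x) ->
  exists c, a <= c <= b /\ f b - f a = d c * (b - a).
Proof.
  intros Hab H.
  destruct (MVT_gen (fun x => f (clamp a b x)) a b d) as (c & Hc & E).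
  - rewrite Rmin_left, Rmax_right by lra. intros x Hx.
    apply is_derive_Reals, derivable_pt_lim_D_in.
    assert (L : D_in f d no_cond x).
    { apply derivable_pt_lim_D_in. apply (D_in_interior f d D a b); trivial.
      - intros; now apply H.
      - apply H; lra. }
    apply (D_in_local _ _ _ _ _ _ _ L); trivial.
    { apply f_equal, clamp_id; lra. }
    exists (Rmin (x - a) (b - x)). split; [apply Rmin_glb_lt; lra|].
    intros y _ Hy. split; [exact I|].
    assert (Hy1 := Rlt_le_trans _ _ _ Hy (Rmin_l _ _)).
    assert (Hy2 := Rlt_le_trans _ _ _ Hy (Rmin_r _ _)).
    apply Rabs_def2 in Hy1. apply Rabs_def2 in Hy2.
    apply f_equal, clamp_id; lra.
  - intros x _. apply (clamp_continuous f D a b Hab).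
    intros y Hy. split; [now apply H|]. eapply cont_deriv. now apply H.
  - rewrite Rmin_left, Rmax_right in Hc by lra.
    rewrite !clamp_id in E by lra. eauto.
Qed.

Lemma D_in_nonincreasing f d (D : R -> Prop) a b :
  a <= b -> (forall x, a <= x <= b -> D x /\ D_in f d D x /\ d x <= 0) ->
  f b <= f a.
Proof.
  intros Hab H.
  destruct (D_in_mvt f d D a b Hab) as (c & Hc & E).
  { intros x Hx. split; now apply H. }
  assert (d c <= 0) by now apply H. nra.
Qed.

Lemma is_derive_D_in f d (D : R -> Prop) x :
  is_derive f x (d x) -> D_in f d D x.
Proof.
  intros H. apply (D_in_imp _ _ no_cond); [easy|].
  now apply derivable_pt_lim_D_in, is_derive_Reals.
Qed.

Lemma is_derive_continuity_pt f x l : is_derive f x l -> continuity_pt f x.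
Proof.
  intros H. apply derivable_continuous_pt. exists l. now apply is_derive_Reals.
Qed.

(** * Planar systems with a bounded Lipschitz field *)

Definition lipschitz_field (K : R) (f : R -> R -> R -> R) : Prop :=
  (forall x y z, Rabs (f x y z) <= K) /\
  (forall x y z x' y' z', Rabs (f x y z - f x' y' z') <=
     K * (Rabs (x - x') + Rabs (y - y') + Rabs (z - z'))).

Definition solves (f g : R -> R -> R -> R) (D : R -> Prop) (y z : R -> R) : Prop :=
  forall x, D x -> D_in y (fun s => f s (y s) (z s)) D x /\
                   D_in z (fun s => g s (y s) (z s)) D x.

Lemma solves_opp f g D y z :
  solves f g D y z ->
  solves (fun x u v => - f (- x) u v) (fun x u v => - g (- x) u v)
    (fun x => D (- x)) (fun x => y (- x)) (fun x => z (- x)).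
Proof.
  intros H x Dx. destruct (H _ Dx) as (Hy & Hz). split.
  - exact (D_in_opp _ _ _ _ Hy).
  - exact (D_in_opp _ _ _ _ Hz).
Qed.

Lemma solves_unique_right K f g D y1 z1 y2 z2 x0 x :
  lipschitz_field K f -> lipschitz_field K g -> convex D ->
  solves f g D y1 z1 -> solves f g D y2 z2 ->
  D x0 -> D x -> x0 <= x -> y1 x0 = y2 x0 -> z1 x0 = z2 x0 ->
  y1 x = y2 x /\ z1 x = z2 x.
Proof.
  intros (_ & Lf) (_ & Lg) CD S1 S2 D0 Dx Hx Ey Ez.
  (* The squared distance grows at rate 4 K at most. *)
  set (e := fun s => ((y1 s - y2 s) * (y1 s - y2 s) + (z1 s - z2 s) * (z1 s - z2 s))
                     * exp (- (4 * K) * s)).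
  assert (E : e x <= e x0).
  { refine (D_in_nonincreasing e _ D x0 x Hx _). intros s Hs.
    assert (Ds : D s) by (now apply (CD x0 s x)).
    destruct (S1 s Ds) as (A1 & B1). destruct (S2 s Ds) as (A2 & B2).
    split; trivial. split.
    - assert (Ay := Dminus _ _ _ _ _ _ A1 A2). assert (Az := Dminus _ _ _ _ _ _ B1 B2).
      assert (Ae : D_in (fun s => exp (- (4 * K) * s))
                     (fun s => - (4 * K) * exp (- (4 * K) * s)) D s).
      { apply (is_derive_D_in _ (fun s => - (4 * K) * exp (- (4 * K) * s))).
        auto_derive; trivial. ring. }
      exact (Dmult _ _ _ _ _ _
               (Dadd _ _ _ _ _ _ (Dmult _ _ _ _ _ _ Ay Ay) (Dmult _ _ _ _ _ _ Az Az)) Ae).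
    - cbv beta.
      assert (F := Lf s (y1 s) (z1 s) s (y2 s) (z2 s)).
      assert (G := Lg s (y1 s) (z1 s) s (y2 s) (z2 s)).
      rewrite Rminus_diag, Rabs_R0 in F, G.
      assert (P := exp_pos (- (4 * K) * s)).
      set (ef := f s (y1 s) (z1 s) - f s (y2 s) (z2 s)) in *.
      set (eg := g s (y1 s) (z1 s) - g s (y2 s) (z2 s)) in *.
      set (dy := y1 s - y2 s) in *. set (dz := z1 s - z2 s) in *.
      set (E := exp _) in *.
      assert (Qy : dy * ef <= Rabs dy * (K * (Rabs dy + Rabs dz))).
      { apply Rle_trans with (Rabs (dy * ef)); [apply Rle_abs|].
        rewrite Rabs_mult. apply Rmult_le_compat_l; [apply Rabs_pos | lra]. }
      assert (Qz : dz * eg <= Rabs dz * (K * (Rabs dy + Rabs dz))).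
      { apply Rle_trans with (Rabs (dz * eg)); [apply Rle_abs|].
        rewrite Rabs_mult. apply Rmult_le_compat_l; [apply Rabs_pos | lra]. }
      assert (Sy : dy * dy = Rabs dy * Rabs dy).
      { rewrite <- Rabs_mult, Rabs_pos_eq; nra. }
      assert (Sz : dz * dz = Rabs dz * Rabs dz).
      { rewrite <- Rabs_mult, Rabs_pos_eq; nra. }
      assert (PK : 0 <= K * (Rabs dy - Rabs dz) ^ 2).
      { assert (0 <= K * (Rabs dy + Rabs dz)).
        { eapply Rle_trans; [apply (Rabs_pos ef)|]. lra. }
        assert (A1' := Rabs_pos dy). assert (A2' := Rabs_pos dz).
        destruct (Rle_dec 0 K); [apply Rmult_le_pos; [lra | apply pow2_ge_0]|].
        assert (Rabs dy + Rabs dz <= 0) by nra.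
        replace (Rabs dy) with 0 by lra. replace (Rabs dz) with 0 by lra. lra. }
      assert (ef * dy + dy * ef + (eg * dz + dz * eg)
              - 4 * K * (dy * dy + dz * dz) <= 0) by (rewrite Sy, Sz; lra).
      replace ((ef * dy + dy * ef + (eg * dz + dz * eg)) * E +
               (dy * dy + dz * dz) * (- (4 * K) * E))
        with ((ef * dy + dy * ef + (eg * dz + dz * eg)
              - 4 * K * (dy * dy + dz * dz)) * E) by ring.
      nra. }
  unfold e in E. rewrite Ey, Ez in E.
  rewrite !Rminus_diag, Rmult_0_r, Rplus_0_r, Rmult_0_l in E.
  assert (P := exp_pos (- (4 * K) * x)).
  set (dy := y1 x - y2 x) in *. set (dz := z1 x - z2 x) in *.
  assert (dy * dy + dz * dz <= 0) by nra.
  assert (dy = 0) by nra. assert (dz = 0) by nra. unfold dy, dz in *. lra.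
Qed.

Lemma lipschitz_field_opp K f :
  lipschitz_field K f -> lipschitz_field K (fun x u v => - f (- x) u v).
Proof.
  intros (B & L). split; intros.
  - rewrite Rabs_Ropp. apply B.
  - replace (- f (- x) y z - - f (- x') y' z') with (- (f (- x) y z - f (- x') y' z')) by ring.
    rewrite Rabs_Ropp. eapply Rle_trans; [apply L|].
    replace (- x - - x') with (- (x - x')) by ring. rewrite Rabs_Ropp. lra.
Qed.

Lemma convex_opp D : convex D -> convex (fun x => D (- x)).
Proof. intros C x y z Dx Dz H. apply (C (- z) (- y) (- x)); trivial. lra. Qed.

(** Gronwall's inequality for the squared distance of two solutions. *)
Lemma solves_unique K f g D y1 z1 y2 z2 x0 x :
  lipschitz_field K f -> lipschitz_field K g -> convex D ->
  solves f g D y1 z1 -> solves f g D y2 z2 ->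
  D x0 -> D x -> y1 x0 = y2 x0 -> z1 x0 = z2 x0 ->
  y1 x = y2 x /\ z1 x = z2 x.
Proof.
  intros Lf Lg CD S1 S2 D0 Dx Ey Ez. destruct (Rle_dec x0 x) as [h|h].
  - now apply (solves_unique_right K f g D y1 z1 y2 z2 x0 x).
  - assert (U := solves_unique_right K _ _ _ _ _ _ _ (- x0) (- x)
      (lipschitz_field_opp _ _ Lf) (lipschitz_field_opp _ _ Lg) (convex_opp _ CD)
      (solves_opp _ _ _ _ _ S1) (solves_opp _ _ _ _ _ S2)).
    cbv beta in U. rewrite !Ropp_involutive in U. apply U; trivial. lra.
Qed.

Lemma le_of_le_geometric a b C : (forall n, a <= b + C * (1/2) ^ n) -> a <= b.
Proof.
  intros H. destruct (Rle_dec a b) as [h|h]; trivial. exfalso.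
  assert (HC : 0 < Rabs C + 1) by (assert (Q := Rabs_pos C); lra).
  destruct (pow_lt_1_zero (1/2)) with (y := (a - b) / (Rabs C + 1)) as (N & HN).
  { rewrite Rabs_pos_eq; lra. }
  { apply Rdiv_lt_0_compat; lra. }
  specialize (HN N (le_n N)). specialize (H N).
  assert (P : 0 < (1/2) ^ N) by (apply pow_lt; lra).
  rewrite Rabs_pos_eq in HN by lra.
  apply Rlt_div_r in HN; [|lra].
  assert (Q := Rle_abs C). nra.
Qed.

Lemma geometric_limit (u : nat -> R) C :
  (forall n, Rabs (u (S n) - u n) <= C * (1/2) ^ n) ->
  exists l, forall n, Rabs (u n - l) <= 2 * C * (1/2) ^ n.
Proof.
  intros H.
  set (a := fun n => u n - 2 * C * (1/2) ^ n). set (b := fun n => u n + 2 * C * (1/2) ^ n).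
  assert (Ha : forall n, a n <= a (S n)).
  { intros n. assert (K := H n). apply Rabs_le_between in K. unfold a. simpl. lra. }
  assert (Hb : forall n, b (S n) <= b n).
  { intros n. assert (K := H n). apply Rabs_le_between in K. unfold b. simpl. lra. }
  assert (Hab : forall n, a n <= b n).
  { intros n. assert (K := H n). assert (P := Rabs_pos (u (S n) - u n)).
    unfold a, b. lra. }
  assert (Ia : forall n m, (n <= m)%nat -> a n <= a m).
  { intros n m L. induction L; [lra|]. assert (Q := Ha m). lra. }
  assert (Ib : forall n m, (n <= m)%nat -> b m <= b n).
  { intros n m L. induction L; [lra|]. assert (Q := Hb m). lra. }
  assert (I : forall n m, a n <= b m).
  { intros n m. destruct (Nat.le_ge_cases n m) as [L|L].
    - assert (Q := Ia _ _ L). assert (Q' := Hab m). lra.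
    - assert (Q := Ib _ _ L). assert (Q' := Hab n). lra. }
  destruct (completeness (fun r => exists n, r = a n)) as (l & U & L).
  { exists (b O). intros r (n & ->). apply I. }
  { exists (a O). now exists O. }
  exists l. intros n. apply Rabs_le_between.
  assert (A : a n <= l) by (apply U; now exists n).
  assert (B : l <= b n) by (apply L; intros r (m & ->); apply I).
  unfold a, b in *. lra.
Qed.

Definition lipschitz (K : R) (y : R -> R) : Prop :=
  forall s t, Rabs (y s - y t) <= K * Rabs (s - t).

Lemma lipschitz_continuous K y x : lipschitz K y -> continuous y x.
Proof.
  intros H. apply continuity_pt_filterlim, continuity_pt_iff. intros eps He.
  assert (PK : 0 < Rabs K + 1) by (assert (Q := Rabs_pos K); lra).
  exists (eps / (Rabs K + 1)). split; [apply Rdiv_lt_0_compat; lra|].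
  intros s Hs. apply Rlt_div_r in Hs; [|lra].
  eapply Rle_lt_trans; [apply H|].
  assert (Q := Rle_abs K). assert (Q' := Rabs_pos (s - x)). nra.
Qed.

Lemma lipschitz_of_derive K y dy :
  (forall x, is_derive y x (dy x)) -> (forall x, Rabs (dy x) <= K) -> lipschitz K y.
Proof.
  intros H B s t.
  destruct (MVT_gen y t s dy) as (c & _ & E).
  - intros; apply H.
  - intros. eapply is_derive_continuity_pt, H.
  - rewrite E, Rabs_mult. apply Rmult_le_compat_r; [apply Rabs_pos | apply B].
Qed.

Lemma is_derive_primitive (c : R) (phi : R -> R) x :
  (forall s, continuous phi s) -> is_derive (fun s => c + RInt phi 0 s) x (phi x).
Proof.
  intros C.
  assert (D : is_derive (RInt phi 0) x (phi x)).
  { apply is_derive_RInt with (a := 0); [|apply C].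
    exists (mkposreal 1 Rlt_0_1). intros s _.
    apply RInt_correct, ex_RInt_continuous. intros; apply C. }
  replace (phi x) with (0 + phi x) by ring.
  apply (is_derive_plus (fun _ => c) (RInt phi 0)); trivial.
  apply (is_derive_const (V := R_NormedModule)).
Qed.

Lemma exp_growth_right (phi dphi : R -> R) (k B x : R) :
  0 <= x -> 0 <= B -> (forall s, is_derive phi s (dphi s)) -> phi 0 = 0 ->
  (forall s, Rabs (dphi s) <= B * k * exp (k * Rabs s)) ->
  Rabs (phi x) <= B * exp (k * Rabs x).
Proof.
  intros Hx HB H H0 L.
  assert (E : forall s, is_derive (fun s => B * exp (k * s)) s (B * k * exp (k * s))).
  { intros s. auto_derive; trivial. ring. }
  assert (G : forall sg, sg = 1 \/ sg = -1 ->
     sg * phi x - B * exp (k * x) <= sg * phi 0 - B * exp (k * 0)).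
  { intros sg Hsg.
    refine (D_in_nonincreasing (fun s => sg * phi s - B * exp (k * s))
      (fun s => sg * dphi s - B * k * exp (k * s)) no_cond 0 x Hx _).
    intros s Hs. split; [exact I|]. split.
    - apply Dminus.
      + apply Dmult_const, is_derive_D_in, H.
      + apply (is_derive_D_in _ (fun s => B * k * exp (k * s))), E.
    - assert (Q := L s). rewrite (Rabs_pos_eq s) in Q by lra.
      apply Rabs_le_between in Q. destruct Hsg as [-> | ->]; lra. }
  assert (G1 := G 1 (or_introl eq_refl)). assert (G2 := G (-1) (or_intror eq_refl)).
  rewrite H0, Rmult_0_r, Rmult_0_r, exp_0 in *.
  rewrite (Rabs_pos_eq x Hx). apply Rabs_le_between. lra.
Qed.

(** A primitive of [B * k * exp (k |x|)] is at most [B * exp (k |x|)]: in the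
    weighted norm sup |phi x| exp (- k |x|), integration contracts by [1/k]. *)
Lemma exp_growth (phi dphi : R -> R) (k B x : R) :
  0 <= B -> (forall s, is_derive phi s (dphi s)) -> phi 0 = 0 ->
  (forall s, Rabs (dphi s) <= B * k * exp (k * Rabs s)) ->
  Rabs (phi x) <= B * exp (k * Rabs x).
Proof.
  intros HB H H0 L. destruct (Rle_dec 0 x) as [h|h].
  - now apply exp_growth_right with dphi.
  - assert (Q : Rabs ((fun s => phi (- s)) (- x)) <= B * exp (k * Rabs (- x))).
    { apply (exp_growth_right (fun s => phi (- s)) (fun s => - dphi (- s))); trivial.
      - lra.
      - intros s. replace (- dphi (- s)) with (scal (-1) (dphi (- s))).
        + apply (is_derive_comp phi Ropp); [apply H|]. auto_derive; trivial.
        + unfold scal; simpl; unfold mult; simpl. ring.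
      - now rewrite Ropp_0.
      - intros s. rewrite Rabs_Ropp. assert (Ls := L (- s)). now rewrite Rabs_Ropp in Ls. }
    cbv beta in Q. now rewrite Ropp_involutive, Rabs_Ropp in Q.
Qed.

Section Picard.
Variables (K : R) (f g : R -> R -> R -> R) (y0 z0 : R).
Hypotheses (PK : 0 < K) (Lf : lipschitz_field K f) (Lg : lipschitz_field K g).

Fixpoint picard (n : nat) : (R -> R) * (R -> R) :=
  match n with
  | O => (fun _ => y0, fun _ => z0)
  | S m => (fun x => y0 + RInt (fun s => f s (fst (picard m) s) (snd (picard m) s)) 0 x,
            fun x => z0 + RInt (fun s => g s (fst (picard m) s) (snd (picard m) s)) 0 x)
  end.

Lemma field_continuous h y z x :
  lipschitz_field K h -> lipschitz K y -> lipschitz K z ->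
  continuous (fun s => h s (y s) (z s)) x.
Proof.
  intros (_ & L) Ly Lz. apply (lipschitz_continuous (K * (1 + K + K))). intros s t.
  eapply Rle_trans; [apply L|]. rewrite Rmult_assoc.
  apply Rmult_le_compat_l; [lra|].
  assert (A := Ly s t). assert (B := Lz s t). lra.
Qed.

Lemma primitive_lipschitz h y z c :
  lipschitz_field K h -> lipschitz K y -> lipschitz K z ->
  lipschitz K (fun x => c + RInt (fun s => h s (y s) (z s)) 0 x).
Proof.
  intros Lh Ly Lz. apply lipschitz_of_derive with (fun s => h s (y s) (z s)).
  - intros. apply (is_derive_primitive c (fun s => h s (y s) (z s))).
    intros. now apply field_continuous.
  - intros. apply Lh.
Qed.

Lemma picard_lipschitz n :
  lipschitz K (fst (picard n)) /\ lipschitz K (snd (picard n)).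
Proof.
  induction n as [|n (I1 & I2)]; simpl.
  - split; intros s t; rewrite Rminus_diag, Rabs_R0;
      apply Rmult_le_pos; try apply Rabs_pos; lra.
  - split; now apply primitive_lipschitz.
Qed.

Lemma primitive_contraction h c B y z y' z' x :
  lipschitz_field K h -> lipschitz K y -> lipschitz K z ->
  lipschitz K y' -> lipschitz K z' -> 0 <= B ->
  (forall s, Rabs (y s - y' s) <= 2 * B * exp (4 * K * Rabs s)) ->
  (forall s, Rabs (z s - z' s) <= 2 * B * exp (4 * K * Rabs s)) ->
  Rabs ((c + RInt (fun s => h s (y s) (z s)) 0 x)
        - (c + RInt (fun s => h s (y' s) (z' s)) 0 x)) <= B * exp (4 * K * Rabs x).
Proof.
  intros Lh Ly Lz Ly' Lz' HB Hy Hz.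
  apply (exp_growth (fun x => (c + RInt (fun s => h s (y s) (z s)) 0 x)
                            - (c + RInt (fun s => h s (y' s) (z' s)) 0 x))
           (fun s => h s (y s) (z s) - h s (y' s) (z' s))); trivial.
  - intros s. apply (is_derive_minus (V := R_NormedModule)).
    + apply (is_derive_primitive c (fun s => h s (y s) (z s))).
      intros. now apply field_continuous.
    + apply (is_derive_primitive c (fun s => h s (y' s) (z' s))).
      intros. now apply field_continuous.
  - rewrite !RInt_point. apply Rminus_diag.
  - intros s. eapply Rle_trans; [apply Lh|].
    rewrite Rminus_diag, Rabs_R0. assert (A := Hy s). assert (B' := Hz s). nra.
Qed.

Lemma picard_step n x :
  Rabs (fst (picard (S n)) x - fst (picard n) x) <= (1/2) ^ n * exp (4 * K * Rabs x) /\
  Rabs (snd (picard (S n)) x - snd (picard n) x) <= (1/2) ^ n * exp (4 * K * Rabs x).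
Proof.
  revert x. induction n as [|n I]; intros x.
  - assert (G : forall h c, lipschitz_field K h ->
      Rabs (c + RInt (fun s => h s y0 z0) 0 x - c) <= 1 * exp (4 * K * Rabs x)).
    { intros h c Lh.
      apply (exp_growth (fun x => c + RInt (fun s => h s y0 z0) 0 x - c)
               (fun s => h s y0 z0)); [lra| | |].
      - intros s.
        replace (h s y0 z0) with (h s y0 z0 - 0) by ring.
        apply (is_derive_minus (V := R_NormedModule)).
        + apply (is_derive_primitive c (fun s => h s y0 z0)). intros.
          apply (field_continuous h (fun _ => y0) (fun _ => z0) _ Lh);
            apply (picard_lipschitz 0).
        + apply (is_derive_const (V := R_NormedModule)).
      - rewrite RInt_point. unfold zero; simpl. ring.
      - intros s. eapply Rle_trans; [apply Lh|].
        assert (A := Rabs_pos s). assert (E := exp_ineq1_le (4 * K * Rabs s)). nra. }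
    simpl. split; apply G; trivial.
  - assert (P : 0 <= (1/2) ^ S n) by (apply pow_le; lra).
    destruct (picard_lipschitz n) as (A1 & A2).
    destruct (picard_lipschitz (S n)) as (A3 & A4).
    split; apply primitive_contraction; trivial; intros s;
      (eapply Rle_trans; [apply I|]); simpl; lra.
Qed.

(** Picard iteration converges geometrically in the weighted norm
    sup |y x| exp (- 4 K |x|), hence on the whole line at once. *)
Lemma picard_exists :
  exists Y Z : R -> R, Y 0 = y0 /\ Z 0 = z0 /\
    forall x, is_derive Y x (f x (Y x) (Z x)) /\ is_derive Z x (g x (Y x) (Z x)).
Proof.
  set (w := fun x => exp (4 * K * Rabs x)).
  set (lim := fun (u : nat -> R -> R) x => epsilon (inhabits 0)
    (fun l => forall n, Rabs (u n x - l) <= 2 * w x * (1/2) ^ n)).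
  set (u := fun n => fst (picard n)). set (v := fun n => snd (picard n)).
  assert (Hu : forall n x, Rabs (u n x - lim u x) <= 2 * w x * (1/2) ^ n).
  { intros n x. revert n. unfold lim. apply epsilon_spec, geometric_limit.
    intros n. rewrite Rmult_comm. apply (picard_step n x). }
  assert (Hv : forall n x, Rabs (v n x - lim v x) <= 2 * w x * (1/2) ^ n).
  { intros n x. revert n. unfold lim. apply epsilon_spec, geometric_limit.
    intros n. rewrite Rmult_comm. apply (picard_step n x). }
  assert (Lip : forall t, (forall n, lipschitz K (t n)) ->
    (forall n x, Rabs (t n x - lim t x) <= 2 * w x * (1/2) ^ n) -> lipschitz K (lim t)).
  { intros t Lt Ht a b. apply (le_of_le_geometric _ _ (2 * w a + 2 * w b)). intros n.
    assert (A := Lt n a b). assert (B := Ht n a). assert (C := Ht n b).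
    replace (lim t a - lim t b)
      with (- (t n a - lim t a) + ((t n a - t n b) + (t n b - lim t b))) by ring.
    eapply Rle_trans; [apply Rabs_triang|]. rewrite Rabs_Ropp.
    assert (Q := Rabs_triang (t n a - t n b) (t n b - lim t b)). lra. }
  assert (Lu : lipschitz K (lim u)) by (apply Lip; trivial; intros; apply picard_lipschitz).
  assert (Lv : lipschitz K (lim v)) by (apply Lip; trivial; intros; apply picard_lipschitz).
  set (Y := fun x => y0 + RInt (fun s => f s (lim u s) (lim v s)) 0 x).
  set (Z := fun x => z0 + RInt (fun s => g s (lim u s) (lim v s)) 0 x).
  assert (Fix : forall h c (t : nat -> R -> R), lipschitz_field K h ->
    (forall n x, t (S n) x = c + RInt (fun s => h s (u n s) (v n s)) 0 x) ->
    (forall n x, Rabs (t n x - lim t x) <= 2 * w x * (1/2) ^ n) ->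
    forall x, c + RInt (fun s => h s (lim u s) (lim v s)) 0 x = lim t x).
  { intros h c t Lh Et Ht x.
    set (a := c + RInt (fun s => h s (lim u s) (lim v s)) 0 x).
    assert (Rabs (a - lim t x) <= 0).
    { apply (le_of_le_geometric _ _ (2 * w x)). intros n.
      assert (A := Ht (S n) x). rewrite Et in A. simpl in A.
      assert (B : Rabs (a - (c + RInt (fun s => h s (u n s) (v n s)) 0 x))
                  <= (1/2) ^ n * w x).
      { unfold a. destruct (picard_lipschitz n).
        apply primitive_contraction; trivial.
        - apply pow_le; lra.
        - intros s. rewrite Rabs_minus_sym. eapply Rle_trans; [apply Hu|]. unfold w. lra.
        - intros s. rewrite Rabs_minus_sym. eapply Rle_trans; [apply Hv|]. unfold w. lra. }
      replace (a - lim t x) with ((a - (c + RInt (fun s => h s (u n s) (v n s)) 0 x))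
        + (c + RInt (fun s => h s (u n s) (v n s)) 0 x - lim t x)) by ring.
      eapply Rle_trans; [apply Rabs_triang|]. lra. }
    assert (P := Rabs_pos (a - lim t x)).
    destruct (Req_dec (a - lim t x) 0) as [e|e]; [lra|].
    apply Rabs_pos_lt in e. lra. }
  assert (EY : forall x, Y x = lim u x) by (apply Fix; trivial).
  assert (EZ : forall x, Z x = lim v x) by (apply Fix; trivial).
  exists Y, Z. split; [|split; [|intros x; split]].
  - unfold Y. rewrite RInt_point. apply Rplus_0_r.
  - unfold Z. rewrite RInt_point. apply Rplus_0_r.
  - rewrite EY, EZ. apply (is_derive_primitive y0 (fun s => f s (lim u s) (lim v s))).
    intros. now apply field_continuous.
  - rewrite EY, EZ. apply (is_derive_primitive z0 (fun s => g s (lim u s) (lim v s))).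
    intros. now apply field_continuous.
Qed.
End Picard.

(** * The truncated equation *)

Definition bounded_lipschitz (f : R -> R -> R -> R) : Prop := exists K, lipschitz_field K f.

(** Local means here on the bounded parts of [P]: a composite with a bounded
    function then has a uniform constant. *)
Definition locally_lipschitz (P : R -> Prop) (phi : R -> R) : Prop :=
  forall B, exists C, forall u v, P u -> P v -> Rabs u <= B -> Rabs v <= B ->
    Rabs (phi u) <= C /\ Rabs (phi u - phi v) <= C * Rabs (u - v).

Lemma lipschitz_field_le K K' f : K <= K' -> lipschitz_field K f -> lipschitz_field K' f.
Proof.
  intros HK (B & L). split; intros.
  - eapply Rle_trans; [apply B | trivial].
  - eapply Rle_trans; [apply L|]. apply Rmult_le_compat_r; trivial.
    assert (A1 := Rabs_pos (x - x')). assert (A2 := Rabs_pos (y - y')).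
    assert (A3 := Rabs_pos (z - z')). lra.
Qed.

Lemma bounded_lipschitz_ext f g : (forall x y z, f x y z = g x y z) -> bounded_lipschitz f -> bounded_lipschitz g.
Proof.
  intros E (K & B & L). exists K. split; intros; rewrite <- !E; trivial.
Qed.

Lemma bounded_lipschitz_const c : bounded_lipschitz (fun _ _ _ => c).
Proof.
  exists (Rabs c). split; intros; [lra|]. rewrite Rminus_diag, Rabs_R0.
  apply Rmult_le_pos; [apply Rabs_pos|].
  assert (A1 := Rabs_pos (x - x')). assert (A2 := Rabs_pos (y - y')).
  assert (A3 := Rabs_pos (z - z')). lra.
Qed.

Lemma bounded_lipschitz_plus f g : bounded_lipschitz f -> bounded_lipschitz g -> bounded_lipschitz (fun x y z => f x y z + g x y z).
Proof.
  intros (K & B & L) (K' & B' & L'). exists (K + K'). split; intros.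
  - assert (A := B x y z). assert (A' := B' x y z).
    eapply Rle_trans; [apply Rabs_triang | lra].
  - assert (A := L x y z x' y' z'). assert (A' := L' x y z x' y' z').
    replace (f x y z + g x y z - (f x' y' z' + g x' y' z'))
      with ((f x y z - f x' y' z') + (g x y z - g x' y' z')) by ring.
    eapply Rle_trans; [apply Rabs_triang | lra].
Qed.

Lemma bounded_lipschitz_mult f g : bounded_lipschitz f -> bounded_lipschitz g -> bounded_lipschitz (fun x y z => f x y z * g x y z).
Proof.
  intros (K & B & L) (K' & B' & L'). exists (2 * (K * K')).
  assert (PK : 0 <= K) by (eapply Rle_trans; [apply Rabs_pos | apply (B 0 0 0)]).
  assert (PK' : 0 <= K') by (eapply Rle_trans; [apply Rabs_pos | apply (B' 0 0 0)]).
  split; intros.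
  - rewrite Rabs_mult.
    assert (Rabs (f x y z) * Rabs (g x y z) <= K * K')
      by (apply Rmult_le_compat; try apply Rabs_pos; trivial).
    assert (0 <= K * K') by now apply Rmult_le_pos. lra.
  - replace (f x y z * g x y z - f x' y' z' * g x' y' z')
      with (f x y z * (g x y z - g x' y' z') + (f x y z - f x' y' z') * g x' y' z') by ring.
    eapply Rle_trans; [apply Rabs_triang|]. rewrite !Rabs_mult.
    set (d := Rabs (x - x') + Rabs (y - y') + Rabs (z - z')).
    assert (Rabs (f x y z) * Rabs (g x y z - g x' y' z') <= K * (K' * d))
      by (apply Rmult_le_compat; try apply Rabs_pos; trivial; apply L').
    assert (Rabs (f x y z - f x' y' z') * Rabs (g x' y' z') <= K * d * K')
      by (apply Rmult_le_compat; try apply Rabs_pos; trivial; apply L).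
    lra.
Qed.

Lemma bounded_lipschitz_comp (P : R -> Prop) phi f :
  locally_lipschitz P phi -> (forall x y z, P (f x y z)) -> bounded_lipschitz f ->
  bounded_lipschitz (fun x y z => phi (f x y z)).
Proof.
  intros HB HP (K & B & L). destruct (HB K) as (C & HC).
  assert (PK : 0 <= K) by (eapply Rle_trans; [apply Rabs_pos | apply (B 0 0 0)]).
  assert (PC : 0 <= C).
  { eapply Rle_trans; [apply Rabs_pos | apply (HC (f 0 0 0) (f 0 0 0)); trivial]. }
  exists (C + C * K). assert (0 <= C * K) by now apply Rmult_le_pos.
  split; intros.
  - assert (A : Rabs (phi (f x y z)) <= C) by now apply (HC _ (f x y z)). lra.
  - destruct (HC (f x y z) (f x' y' z')) as (_ & A); trivial.
    eapply Rle_trans; [apply A|].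
    assert (A1 := Rabs_pos (x - x')). assert (A2 := Rabs_pos (y - y')).
    assert (A3 := Rabs_pos (z - z')). assert (A4 := L x y z x' y' z').
    assert (C * Rabs (f x y z - f x' y' z')
            <= C * (K * (Rabs (x - x') + Rabs (y - y') + Rabs (z - z'))))
      by now apply Rmult_le_compat_l.
    assert (0 <= C * (Rabs (x - x') + Rabs (y - y') + Rabs (z - z')))
      by (apply Rmult_le_pos; lra). lra.
Qed.

(** Cutting off turns an unbounded Lipschitz coordinate into a bounded one. *)
Lemma bounded_lipschitz_clamp K f :
  0 <= K -> (forall x y z x' y' z', Rabs (f x y z - f x' y' z') <=
     Rabs (x - x') + Rabs (y - y') + Rabs (z - z')) ->
  bounded_lipschitz (fun x y z => clamp (- K) K (f x y z)).
Proof.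
  intros HK L. exists (K + 1). split; intros.
  - assert (A := clamp_bounds (- K) K (f x y z)). apply Rabs_le_between. lra.
  - eapply Rle_trans; [apply clamp_lipschitz|]. eapply Rle_trans; [apply L|].
    assert (A1 := Rabs_pos (x - x')). assert (A2 := Rabs_pos (y - y')).
    assert (A3 := Rabs_pos (z - z')). nra.
Qed.

Lemma locally_lipschitz_Rmax s : locally_lipschitz (fun _ => True) (Rmax s).
Proof.
  intros B. exists (Rabs s + Rabs B + 1). intros u v _ _ Hu Hv.
  assert (A1 := Rabs_pos s). assert (A2 := Rle_abs B). assert (A3 := Rabs_pos B). split.
  - unfold Rmax. destruct (Rle_dec s u); lra.
  - apply Rle_trans with (1 * Rabs (u - v)).
    + unfold Rmax, Rabs. repeat destruct (Rle_dec _ _); repeat destruct (Rcase_abs _); lra.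
    + apply Rmult_le_compat_r; [apply Rabs_pos | lra].
Qed.

Lemma locally_lipschitz_exp : locally_lipschitz (fun u => u <= 0) exp.
Proof.
  intros B. exists 1. intros u v Hu Hv _ _.
  assert (E : forall w, w <= 0 -> 0 < exp w <= 1).
  { intros w Hw. split; [apply exp_pos|]. rewrite <- exp_0.
    destruct Hw as [h| ->]; [left; now apply exp_increasing | lra]. }
  split.
  - rewrite Rabs_pos_eq; apply E in Hu; lra.
  - destruct (MVT_gen exp v u exp) as (c & Hc & ->).
    + intros. apply is_derive_exp.
    + intros. eapply is_derive_continuity_pt, is_derive_exp.
    + rewrite Rabs_mult. apply Rmult_le_compat_r; [apply Rabs_pos|].
      assert (Hc0 : c <= 0).
      { apply Rle_trans with (Rmax v u); [apply Hc | now apply Rmax_lub]. }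
      apply E in Hc0. rewrite Rabs_pos_eq; lra.
Qed.

Lemma locally_lipschitz_inv m : 0 < m -> locally_lipschitz (fun u => m <= u) Rinv.
Proof.
  intros Hm B. exists (/ m + / m * / m). intros u v Hu Hv _ _.
  assert (E : forall w, m <= w -> 0 < / w <= / m).
  { intros w Hw. split; [apply Rinv_0_lt_compat; lra | now apply Rinv_le_contravar]. }
  assert (Eu := E u Hu). assert (Ev := E v Hv). split.
  - rewrite Rabs_pos_eq by lra. nra.
  - replace (/ u - / v) with (/ u * / v * - (u - v)) by (field; lra).
    rewrite Rabs_mult, Rabs_Ropp. apply Rmult_le_compat_r; [apply Rabs_pos|].
    rewrite Rabs_pos_eq by nra.
    assert (/ u * / v <= / m * / m) by (apply Rmult_le_compat; lra). lra.
Qed.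

Lemma locally_lipschitz_sqrt m : 0 < m -> locally_lipschitz (fun u => m <= u) sqrt.
Proof.
  intros Hm B. exists (Rabs B + 1 + / sqrt m). intros u v Hu Hv HB _.
  assert (Sm : 0 < sqrt m) by now apply sqrt_lt_R0.
  assert (Im : 0 < / sqrt m) by now apply Rinv_0_lt_compat.
  assert (Su : sqrt m <= sqrt u) by now apply sqrt_le_1_alt.
  assert (Sv : sqrt m <= sqrt v) by now apply sqrt_le_1_alt.
  assert (Qu : sqrt u * sqrt u = u) by (apply sqrt_sqrt; lra).
  assert (Qv : sqrt v * sqrt v = v) by (apply sqrt_sqrt; lra).
  assert (LB := Rle_abs B). rewrite Rabs_pos_eq in HB by lra. split.
  - rewrite Rabs_pos_eq by lra. nra.
  - apply Rle_trans with (/ sqrt m * Rabs (u - v)).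
    + apply (Rmult_le_reg_l (sqrt m)); trivial. rewrite <- Rmult_assoc, Rinv_r, Rmult_1_l by lra.
      replace (u - v) with ((sqrt u + sqrt v) * (sqrt u - sqrt v)) by lra.
      rewrite Rabs_mult. apply Rmult_le_compat_r; [apply Rabs_pos|].
      rewrite Rabs_pos_eq; lra.
    + apply Rmult_le_compat_r; [apply Rabs_pos|]. assert (0 <= Rabs B) by apply Rabs_pos. lra.
Qed.

Lemma locally_lipschitz_mul_sqrt : locally_lipschitz (fun u => 0 <= u <= 1) (fun u => u * sqrt u).
Proof.
  intros B. exists 2. intros u v Hu Hv _ _.
  assert (E : forall w, 0 <= w <= 1 -> 0 <= sqrt w <= 1).
  { intros w Hw. split; [apply sqrt_pos|]. rewrite <- sqrt_1. now apply sqrt_le_1_alt. }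
  assert (Eu := E u Hu). assert (Ev := E v Hv).
  assert (Qu : sqrt u * sqrt u = u) by (apply sqrt_sqrt; lra).
  assert (Qv : sqrt v * sqrt v = v) by (apply sqrt_sqrt; lra).
  set (a := sqrt u) in *. set (b := sqrt v) in *. rewrite <- Qu, <- Qv. split.
  - rewrite Rabs_pos_eq by nra. nra.
  - replace (a * a * a - b * b * b) with ((a * a + a * b + b * b) * (a - b)) by ring.
    replace (a * a - b * b) with ((a + b) * (a - b)) by ring.
    rewrite !Rabs_mult, <- Rmult_assoc.
    apply Rmult_le_compat_r; [apply Rabs_pos|]. rewrite !Rabs_pos_eq by nra. nra.
Qed.

(** The area radius as a function of [s = X ^ 2 - T ^ 2], on which alone it
    depends. *)
Definition radius (M s : R) : R :=
  epsilon (inhabits 0) (fun r => 0 < r /\ (r - 2 * M) * exp (r / (2 * M)) = s).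

Lemma area_radiusE M T X : area_radius M T X = radius M (X ^ 2 - T ^ 2).
Proof. reflexivity. Qed.

Lemma radius_spec M s : 0 < M -> - (2 * M) < s ->
  0 < radius M s /\ (radius M s - 2 * M) * exp (radius M s / (2 * M)) = s.
Proof.
  intros HM Hs. destruct (Rle_dec 0 s) as [h|h].
  - assert (E : sqrt s ^ 2 - 0 ^ 2 = s) by (rewrite pow2_sqrt; lra).
    assert (A := area_radius_spec M 0 (sqrt s) HM). unfold is_area_radius, kruskal_region in A.
    rewrite area_radiusE, E in A. auto.
  - assert (E : 0 ^ 2 - sqrt (- s) ^ 2 = s) by (rewrite pow2_sqrt; lra).
    assert (A := area_radius_spec M (sqrt (- s)) 0 HM). unfold is_area_radius, kruskal_region in A.
    rewrite area_radiusE, E in A. auto.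
Qed.

(** The defining function of the radius has derivative
    [r / (2 * M) * exp (r / (2 * M))], at least [r1 / (2 * M)] beyond [r1]; so
    its inverse is Lipschitz away from the singularity. *)
Lemma radius_equation_expands M r1 r2 : 0 < M -> 0 < r1 <= r2 ->
  r1 / (2 * M) * (r2 - r1) <=
  (r2 - 2 * M) * exp (r2 / (2 * M)) - (r1 - 2 * M) * exp (r1 / (2 * M)).
Proof.
  intros HM Hr.
  assert (D : forall r, is_derive (fun r => (r - 2 * M) * exp (r / (2 * M))) r
                          (r / (2 * M) * exp (r / (2 * M)))).
  { intros r. auto_derive; trivial. unfold Rdiv. field. lra. }
  destruct (MVT_gen _ r1 r2 _ (fun r _ => D r)) as (c & Hc & E).
  - intros. eapply is_derive_continuity_pt, D.
  - rewrite E. rewrite Rmin_left, Rmax_right in Hc by lra.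
    apply Rmult_le_compat_r; [lra|].
    assert (I : 0 < / (2 * M)) by (apply Rinv_0_lt_compat; lra).
    assert (L : r1 / (2 * M) <= c / (2 * M)) by (unfold Rdiv; nra).
    assert (P : 0 < r1 / (2 * M)) by (unfold Rdiv; nra).
    assert (X := exp_ineq1_le (c / (2 * M))). nra.
Qed.

Lemma radius_le M s1 s2 : 0 < M -> - (2 * M) < s1 <= s2 -> radius M s1 <= radius M s2.
Proof.
  intros HM Hs. destruct (radius_spec M s1 HM) as (P1 & E1); [lra|].
  destruct (radius_spec M s2 HM) as (P2 & E2); [lra|].
  destruct (Rle_dec (radius M s1) (radius M s2)) as [h|h]; trivial.
  assert (A := radius_equation_expands M (radius M s2) (radius M s1) HM).
  assert (0 < radius M s2 / (2 * M)) by (apply Rdiv_lt_0_compat; lra). nra.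
Qed.

Lemma locally_lipschitz_radius M s0 : 0 < M -> - (2 * M) < s0 ->
  locally_lipschitz (fun s => s0 <= s) (radius M).
Proof.
  intros HM H0 B. destruct (radius_spec M s0 HM H0) as (P0 & _).
  exists (2 * M + Rabs B + 2 * M / radius M s0).
  assert (PC : 0 < 2 * M / radius M s0) by (apply Rdiv_lt_0_compat; lra).
  assert (Ord : forall u v, s0 <= u <= v ->
            radius M v - radius M u <= 2 * M / radius M s0 * (v - u)).
  { intros u v Huv. destruct (radius_spec M u HM) as (Pu & Eu); [lra|].
    destruct (radius_spec M v HM) as (Pv & Ev); [lra|].
    assert (Lu : radius M s0 <= radius M u) by (apply radius_le; lra).
    assert (Lv : radius M u <= radius M v) by (apply radius_le; lra).
    assert (A := radius_equation_expands M (radius M u) (radius M v) HM (conj Pu Lv)).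
    rewrite Eu, Ev in A.
    assert (I : radius M s0 / (2 * M) * (radius M v - radius M u) <= v - u).
    { eapply Rle_trans; [|exact A]. apply Rmult_le_compat_r; [lra|].
      apply Rmult_le_compat_r; trivial. left. apply Rinv_0_lt_compat; lra. }
    apply (Rmult_le_compat_l (2 * M / radius M s0)) in I; [|lra].
    replace (2 * M / radius M s0 * (radius M s0 / (2 * M) * (radius M v - radius M u)))
      with (radius M v - radius M u) in I by (field; lra). trivial. }
  intros u v Hu Hv Bu Bv. assert (AB := Rle_abs B). assert (AB' := Rabs_pos B). split.
  - destruct (radius_spec M u HM) as (Pu & Eu); [lra|].
    rewrite Rabs_pos_eq by lra. apply Rabs_le_between in Bu.
    destruct (Rle_dec (radius M u) (2 * M)); [lra|].
    assert (X := exp_ineq1_le (radius M u / (2 * M))).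
    assert (0 < radius M u / (2 * M)) by (apply Rdiv_lt_0_compat; lra). nra.
  - assert (E : Rabs (radius M u - radius M v) <= 2 * M / radius M s0 * Rabs (u - v)).
    { destruct (Rle_dec u v).
      - assert (L := Ord u v). assert (radius M u <= radius M v) by (apply radius_le; lra).
        rewrite (Rabs_minus_sym (radius M u)), (Rabs_minus_sym u), !Rabs_pos_eq; lra.
      - assert (L := Ord v u). assert (radius M v <= radius M u) by (apply radius_le; lra).
        rewrite !Rabs_pos_eq; lra. }
    eapply Rle_trans; [exact E|]. apply Rmult_le_compat_r; [apply Rabs_pos | lra].
Qed.

(** The value of [F''] that the SS-CMC equation prescribes at area radius [r]. *)
Definition force (M H r x t p : R) : R :=
  - (exp (- (r / (2 * M))) * (6 * M / r ^ 2 - 1 / r) * (- t + p * x) * (1 - p ^ 2)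
     + 12 * H * M * exp (- (r / (4 * M))) / sqrt r * ((1 - p ^ 2) * sqrt (1 - p ^ 2))).

Lemma ss_cmc_operator_zero M H x t p q : 1 - p ^ 2 > 0 ->
  (ss_cmc_operator M H x t p q = 0 <-> q = force M H (radius M (x ^ 2 - t ^ 2)) x t p).
Proof.
  intros Hp. unfold ss_cmc_operator, force. rewrite area_radiusE. cbv zeta.
  replace (Rpower (1 - p ^ 2) (3 / 2)) with ((1 - p ^ 2) * sqrt (1 - p ^ 2)).
  - split; lra.
  - rewrite <- Rpower_sqrt by lra. rewrite <- (Rpower_1 (1 - p ^ 2)) at 1 by lra.
    rewrite <- Rpower_plus. f_equal. lra.
Qed.

(** The right-hand side of [F' = p], cut off at the speed of light. *)
Definition velocity (x t p : R) : R := clamp (-1) 1 p.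

(** Coincides with the force of the SS-CMC equation as long as [|x|, |t| <= K],
    [|p| <= 1] and [s >= s0]; a level [s0 > - 2 * M] of [s] keeps the radius away
    from [0]. *)
Definition truncated_force (M H s0 K x t p : R) : R :=
  force M H (radius M (Rmax s0 (clamp (- K) K x ^ 2 - clamp (- K) K t ^ 2)))
    (clamp (- K) K x) (clamp (- K) K t) (clamp (-1) 1 p).

Lemma bounded_lipschitz_velocity : bounded_lipschitz velocity.
Proof.
  apply (bounded_lipschitz_clamp 1 (fun x t p => p)); [lra|]. intros.
  assert (A1 := Rabs_pos (x - x')). assert (A2 := Rabs_pos (y - y')). lra.
Qed.

(** Away from the singularity [r = 0] the force is Lipschitz, up to [|p| = 1]
    included because of the exponent 3/2 > 1; cutting off all variables makes it
    globally so. *)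
Lemma bounded_lipschitz_truncated_force M H s0 K : 0 < M -> - (2 * M) < s0 -> 0 <= K ->
  bounded_lipschitz (truncated_force M H s0 K).
Proof.
  intros HM H0 HK.
  set (X := fun x t p : R => clamp (- K) K x).
  set (T := fun x t p : R => clamp (- K) K t).
  set (r := fun x t p => radius M (Rmax s0 (X x t p * X x t p + (-1) * (T x t p * T x t p)))).
  set (q := fun x t p => 1 + (-1) * (velocity x t p * velocity x t p)).
  destruct (radius_spec M s0 HM H0) as (P0 & _). set (r0 := radius M s0) in *.
  assert (BX : bounded_lipschitz X).
  { apply (bounded_lipschitz_clamp K (fun x t p => x)); trivial. intros.
    assert (A1 := Rabs_pos (y - y')). assert (A2 := Rabs_pos (z - z')). lra. }
  assert (BT : bounded_lipschitz T).
  { apply (bounded_lipschitz_clamp K (fun x t p => t)); trivial. intros.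
    assert (A1 := Rabs_pos (x - x')). assert (A2 := Rabs_pos (z - z')). lra. }
  assert (Br : bounded_lipschitz r).
  { apply (bounded_lipschitz_comp _ _ _ (locally_lipschitz_radius M s0 HM H0)).
    - intros. apply Rmax_l.
    - apply (bounded_lipschitz_comp _ _ _ (locally_lipschitz_Rmax s0)); trivial.
      apply bounded_lipschitz_plus; [now apply bounded_lipschitz_mult|]. apply bounded_lipschitz_mult; [apply bounded_lipschitz_const | now apply bounded_lipschitz_mult]. }
  assert (Lr : forall x t p, r0 <= r x t p).
  { intros. apply radius_le; trivial. split; [trivial | apply Rmax_l]. }
  assert (Ir : bounded_lipschitz (fun x t p => / r x t p)).
  { apply (bounded_lipschitz_comp _ _ _ (locally_lipschitz_inv r0 P0)); trivial. }
  assert (Er : forall k, 0 <= k -> bounded_lipschitz (fun x t p => exp ((- k) * r x t p))).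
  { intros k Hk. apply (bounded_lipschitz_comp _ _ _ locally_lipschitz_exp).
    - intros x t p. assert (A := Lr x t p). nra.
    - apply bounded_lipschitz_mult; [apply bounded_lipschitz_const | trivial]. }
  assert (Sr : bounded_lipschitz (fun x t p => / sqrt (r x t p))).
  { apply (bounded_lipschitz_comp _ _ _ (locally_lipschitz_inv (sqrt r0) (sqrt_lt_R0 _ P0))).
    - intros. now apply sqrt_le_1_alt.
    - apply (bounded_lipschitz_comp _ _ _ (locally_lipschitz_sqrt r0 P0)); trivial. }
  assert (Bq : bounded_lipschitz q).
  { apply bounded_lipschitz_plus; [apply bounded_lipschitz_const|]. apply bounded_lipschitz_mult; [apply bounded_lipschitz_const|].
    apply bounded_lipschitz_mult; apply bounded_lipschitz_velocity. }
  assert (Sq : bounded_lipschitz (fun x t p => q x t p * sqrt (q x t p))).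
  { apply (bounded_lipschitz_comp _ _ _ locally_lipschitz_mul_sqrt); trivial. intros x t p. unfold q.
    assert (A : -1 <= velocity x t p <= 1) by (apply clamp_bounds; lra). nra. }
  assert (I2 : 0 < / (2 * M)) by (apply Rinv_0_lt_compat; lra).
  assert (I4 : 0 < / (4 * M)) by (apply Rinv_0_lt_compat; lra).
  apply bounded_lipschitz_ext with (fun x t p => (-1) *
    (exp ((- / (2 * M)) * r x t p) * (6 * M * (/ r x t p * / r x t p) + (-1) * / r x t p)
       * ((-1) * T x t p + velocity x t p * X x t p) * q x t p
     + 12 * H * M * exp ((- / (4 * M)) * r x t p) * / sqrt (r x t p)
       * (q x t p * sqrt (q x t p)))).
  - intros x t p. unfold truncated_force, force.
    assert (E : radius M (Rmax s0 (clamp (- K) K x ^ 2 - clamp (- K) K t ^ 2)) = r x t p).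
    { unfold r, X, T. do 2 f_equal. ring. }
    rewrite E. assert (Q : 1 - clamp (-1) 1 p ^ 2 = q x t p) by (unfold q, velocity; ring).
    rewrite Q. assert (N := Lr x t p).
    replace (- / (2 * M) * r x t p) with (- (r x t p / (2 * M))) by (unfold Rdiv; ring).
    replace (- / (4 * M) * r x t p) with (- (r x t p / (4 * M))) by (unfold Rdiv; ring).
    assert (0 < sqrt (r x t p)) by (apply sqrt_lt_R0; lra).
    unfold velocity, T, X. field. lra.
  - repeat first [apply bounded_lipschitz_const | exact BX | exact BT | exact Ir | exact Sr | exact Bq
                 | exact Sq | apply bounded_lipschitz_velocity | apply Er; lra | apply bounded_lipschitz_plus | apply bounded_lipschitz_mult].
Qed.

Lemma truncated_solution (M H s0 K y0 z0 : R) : 0 < M -> - (2 * M) < s0 -> 0 <= K ->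
  exists Y Z : R -> R, Y 0 = y0 /\ Z 0 = z0 /\
    forall x, is_derive Y x (velocity x (Y x) (Z x)) /\
              is_derive Z x (truncated_force M H s0 K x (Y x) (Z x)).
Proof.
  intros HM H0 HK. destruct bounded_lipschitz_velocity as (K1 & L1).
  destruct (bounded_lipschitz_truncated_force M H s0 K HM H0 HK) as (K2 & L2).
  apply (picard_exists (Rmax K1 K2 + 1)).
  - assert (A : 0 <= K1). { eapply Rle_trans; [apply Rabs_pos | apply (proj1 L1 0 0 0)]. }
    assert (B := Rmax_l K1 K2). lra.
  - apply (lipschitz_field_le K1); trivial. assert (B := Rmax_l K1 K2). lra.
  - apply (lipschitz_field_le K2); trivial. assert (B := Rmax_r K1 K2). lra.
Qed.

Lemma truncated_unique M H s0 K D y1 z1 y2 z2 x0 x :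
  0 < M -> - (2 * M) < s0 -> 0 <= K -> convex D ->
  solves velocity (truncated_force M H s0 K) D y1 z1 ->
  solves velocity (truncated_force M H s0 K) D y2 z2 ->
  D x0 -> D x -> y1 x0 = y2 x0 -> z1 x0 = z2 x0 -> y1 x = y2 x /\ z1 x = z2 x.
Proof.
  intros HM H0 HK. destruct bounded_lipschitz_velocity as (K1 & L1).
  destruct (bounded_lipschitz_truncated_force M H s0 K HM H0 HK) as (K2 & L2).
  apply (solves_unique (Rmax K1 K2)).
  - apply (lipschitz_field_le K1); trivial. apply Rmax_l.
  - apply (lipschitz_field_le K2); trivial. apply Rmax_r.
Qed.

(** The lines of slope [1] and [-1] solve the truncated equation, so a solution
    that is spacelike at one point can never become null. *)
Lemma truncated_spacelike (M H s0 K : R) (Y Z : R -> R) (x : R) :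
  0 < M -> - (2 * M) < s0 -> 0 <= K -> Z 0 = 0 ->
  (forall x, is_derive Y x (velocity x (Y x) (Z x)) /\
             is_derive Z x (truncated_force M H s0 K x (Y x) (Z x))) ->
  -1 < Z x < 1.
Proof.
  intros HM H0 HK Z0 Sol.
  assert (Cc : continuity (fun s => Z (x * s) * Z (x * s) - 1)).
  { intros s. eapply is_derive_continuity_pt.
    assert (A : is_derive (fun s => Z (x * s)) s
              (x * truncated_force M H s0 K (x * s) (Y (x * s)) (Z (x * s)))).
    { apply (is_derive_comp Z (fun s => x * s)); [apply Sol|]. auto_derive; trivial. ring. }
    apply (is_derive_minus (V := R_NormedModule)); [|apply (is_derive_const (V := R_NormedModule))].
    apply (is_derive_mult _ _ _ _ _ A A). intros; apply Rmult_comm. }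
  destruct (Rlt_dec (Z x * Z x) 1) as [h|h]; [nra|]. exfalso.
  (* Otherwise |Z| = 1 at some [x1], and the null line through that point is the
     solution. *)
  destruct (IVT_cor _ 0 1 Cc) as (u & _ & Hu).
  { lra. }
  { rewrite Rmult_0_r, Rmult_1_r, Z0. nra. }
  set (x1 := x * u) in *. assert (Hz : Z x1 * Z x1 = 1) by lra.
  assert (Cl : clamp (-1) 1 (Z x1) = Z x1) by (apply clamp_id; nra).
  destruct (truncated_unique M H s0 K (fun _ => True) Y Z
              (fun s => Y x1 + Z x1 * (s - x1)) (fun _ => Z x1) x1 0) as (_ & E); trivial.
  - easy.
  - intros s _. destruct (Sol s) as (A & B). split.
    + now apply (is_derive_D_in Y (fun s => velocity s (Y s) (Z s))).
    + now apply (is_derive_D_in Z (fun s => truncated_force M H s0 K s (Y s) (Z s))).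
  - intros s _. split.
    + apply (is_derive_D_in _ (fun s => velocity s (Y x1 + Z x1 * (s - x1)) (Z x1))).
      unfold velocity. rewrite Cl. auto_derive; trivial. ring.
    + apply (is_derive_D_in _ (fun s => truncated_force M H s0 K s
                                           (Y x1 + Z x1 * (s - x1)) (Z x1))).
      unfold truncated_force, force. rewrite Cl.
      replace (1 - Z x1 ^ 2) with 0 by (simpl; lra).
      rewrite !Rmult_0_r, Rmult_0_l, Rmult_0_r, Rplus_0_r, Ropp_0.
      apply (is_derive_const (V := R_NormedModule)).
  - ring.
  - nra.
Qed.

(** * Solutions of the SS-CMC equation *)

Definition acceleration (M H x t p : R) : R :=
  force M H (radius M (x ^ 2 - t ^ 2)) x t p.

Definition trajectory (M H : R) (D : R -> Prop) (y z : R -> R) : Prop :=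
  forall x, D x -> kruskal_region M (y x) x /\ -1 < z x < 1 /\
    D_in y z D x /\ D_in z (fun s => acceleration M H s (y s) (z s)) D x.

Lemma ss_cmc_iff M H D F :
  ss_cmc M H D F <-> interval D /\ exists P, trajectory M H D F P.
Proof.
  split.
  - intros (I & Rg & F' & F'' & E). split; trivial. exists F'. intros x Dx.
    destruct (E x Dx) as (D1 & D2 & Sp & Eq). repeat split; auto; try nra.
    apply ss_cmc_operator_zero in Eq; trivial. now apply (D_in_ext F'').
  - intros (I & P & T). split; [|split]; trivial.
    { intros x Dx. apply (T x Dx). }
    exists P, (fun s => acceleration M H s (F s) (P s)). intros x Dx.
    destruct (T x Dx) as (_ & Sp & D1 & D2). assert (1 - P x ^ 2 > 0) by nra.
    repeat split; trivial. now apply ss_cmc_operator_zero.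
Qed.

(** In the region [T ^ 2 < X ^ 2 + 2 * M], so a bound on [X] bounds [T]; the value
    [K + 2 * M + 1] below is a cutoff that no solution over [- K <= X <= K] meets. *)
Lemma kruskal_region_bound M T X K :
  0 < M -> kruskal_region M T X -> -K <= X <= K -> - (K + 2 * M + 1) <= T <= K + 2 * M + 1.
Proof. unfold kruskal_region. intros HM HR HX. split; nra. Qed.

Lemma kruskal_region_convex M T1 T T2 X :
  kruskal_region M T1 X -> kruskal_region M T2 X -> T1 <= T <= T2 -> kruskal_region M T X.
Proof. unfold kruskal_region. intros H1 H2 HT. destruct (Rle_dec 0 T); nra. Qed.

Lemma kruskal_region_opp M T X : kruskal_region M T (- X) <-> kruskal_region M T X.
Proof. unfold kruskal_region. replace ((- X) ^ 2) with (X ^ 2) by ring. tauto. Qed.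

(** Over a compact interval the minimum of [X ^ 2 - T ^ 2] is attained, at a
    regular point. *)
Lemma compact_gap M y (D : R -> Prop) a b :
  a <= b ->
  (forall x, a <= x <= b -> D x /\ continue_in y D x /\ kruskal_region M (y x) x) ->
  exists s, - (2 * M) < s /\ forall x, a <= x <= b -> s <= x ^ 2 - y x ^ 2.
Proof.
  intros Hab HD.
  assert (C : continuity (fun x => (fun x => x) (clamp a b x) * (fun x => x) (clamp a b x)
                       - y (clamp a b x) * y (clamp a b x))).
  { assert (Cy : continuity (fun x => y (clamp a b x)))
      by (apply (clamp_continuous y D a b Hab); intros; split; now apply HD).
    assert (Cx : continuity (fun x => (fun x => x) (clamp a b x))).
    { apply (clamp_continuous (fun x => x) D a b Hab). intros x Hx. split; [now apply HD|].
      apply (cont_deriv _ (fun _ => 1)), Dx. }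
    apply continuity_minus; now apply continuity_mult. }
  destruct (continuity_ab_min _ a b Hab (fun x _ => C x)) as (m & Hm & Im).
  cbv beta in Hm. rewrite (clamp_id a b m Im) in Hm.
  exists (m ^ 2 - y m ^ 2). split.
  - apply HD; trivial.
  - intros x Hx. assert (A := Hm x Hx). rewrite (clamp_id a b x Hx) in A. lra.
Qed.

Lemma trajectory_restrict M H (D D' : R -> Prop) y z :
  (forall x, D' x -> D x) -> trajectory M H D y z -> trajectory M H D' y z.
Proof.
  intros S T x Dx. destruct (T x (S x Dx)) as (A & B & C & E).
  repeat split; trivial; try lra.
  - exact (D_in_imp _ _ _ _ _ S C).
  - exact (D_in_imp _ _ _ _ _ S E).
Qed.

Lemma trajectory_continue M H D y z x :
  trajectory M H D y z -> D x -> continue_in y D x.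
Proof. intros T Dx. eapply cont_deriv. now apply T. Qed.

Lemma acceleration_opp M H x t p : acceleration M H (- x) t (- p) = acceleration M H x t p.
Proof.
  unfold acceleration, force. replace ((- x) ^ 2) with (x ^ 2) by ring.
  replace ((- p) ^ 2) with (p ^ 2) by ring.
  replace (- p * - x) with (p * x) by ring. reflexivity.
Qed.

(** The equation is invariant under the isometry [X -> - X]. *)
Lemma trajectory_opp M H D y z :
  trajectory M H D y z ->
  trajectory M H (fun x => D (- x)) (fun x => y (- x)) (fun x => - z (- x)).
Proof.
  intros T x Dx. destruct (T _ Dx) as (A & B & C & E). repeat split; try lra.
  - exact (proj1 (kruskal_region_opp _ _ _) A).
  - exact (D_in_opp _ _ _ _ C).
  - apply Dopp in E.
    refine (D_in_ext _ _ _ _ _ _ (D_in_opp _ _ _ _ E)).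
    cbv beta. rewrite Ropp_involutive, <- acceleration_opp. now rewrite Ropp_involutive.
Qed.

Lemma trajectory_truncated M H s0 K D y z :
  0 < M -> trajectory M H D y z ->
  (forall x, D x -> - K <= x <= K /\ s0 <= x ^ 2 - y x ^ 2) ->
  solves velocity (truncated_force M H s0 (K + 2 * M + 1)) D y z.
Proof.
  intros HM T B x Dx. destruct (T x Dx) as (Rg & Sp & C & E). destruct (B x Dx) as (Bx & Bs).
  assert (By := kruskal_region_bound _ _ _ _ HM Rg Bx). split.
  - refine (D_in_ext _ _ _ _ _ _ C). unfold velocity. rewrite clamp_id; lra.
  - refine (D_in_ext _ _ _ _ _ _ E). unfold truncated_force, acceleration.
    rewrite !clamp_id by lra. now rewrite Rmax_right.
Qed.

(** Between the two points both solutions stay away from the singularity, hence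
    solve a common truncated equation. *)
Lemma trajectory_unique M H D y1 z1 y2 z2 x0 x :
  0 < M -> convex D -> trajectory M H D y1 z1 -> trajectory M H D y2 z2 ->
  D x0 -> D x -> y1 x0 = y2 x0 -> z1 x0 = z2 x0 -> y1 x = y2 x /\ z1 x = z2 x.
Proof.
  intros HM CD T1 T2 D0 Dx Ey Ez.
  set (a := Rmin x0 x). set (b := Rmax x0 x).
  assert (Ha : a <= x0 <= b) by (split; [apply Rmin_l | apply Rmax_l]).
  assert (Hb : a <= x <= b) by (split; [apply Rmin_r | apply Rmax_r]).
  assert (S : forall s, a <= s <= b -> D s).
  { intros s Hs. unfold a, b, Rmin, Rmax in Hs. destruct (Rle_dec x0 x).
    - now apply (CD x0 s x).
    - now apply (CD x s x0). }
  destruct (compact_gap M y1 D a b) as (s1 & L1 & G1); [lra| |].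
  { intros s Hs. split; [auto|]. split; [|apply T1; auto].
    eapply trajectory_continue; eauto. }
  destruct (compact_gap M y2 D a b) as (s2 & L2 & G2); [lra| |].
  { intros s Hs. split; [auto|]. split; [|apply T2; auto].
    eapply trajectory_continue; eauto. }
  set (D' := fun s => a <= s <= b).
  set (K := Rabs a + Rabs b).
  assert (PK : forall s, D' s -> - K <= s <= K).
  { intros s Hs. unfold K. unfold D' in Hs.
    assert (A1 := Rabs_pos a). assert (A2 := Rabs_pos b).
    assert (A3 := Rle_abs b). assert (A4 := Rle_abs (- a)). rewrite Rabs_Ropp in A4. lra. }
  assert (PK0 : 0 <= K).
  { unfold K. assert (A1 := Rabs_pos a). assert (A2 := Rabs_pos b). lra. }
  apply (truncated_unique M H (Rmin s1 s2) (K + 2 * M + 1) D' y1 z1 y2 z2 x0 x); trivial.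
  - now apply Rmin_glb_lt.
  - lra.
  - intros u v w Hu Hw Hv. unfold D' in *. lra.
  - apply trajectory_truncated; trivial.
    + now apply (trajectory_restrict _ _ D).
    + intros s Hs. split; auto. eapply Rle_trans; [apply Rmin_l | auto].
  - apply trajectory_truncated; trivial.
    + now apply (trajectory_restrict _ _ D).
    + intros s Hs. split; auto. eapply Rle_trans; [apply Rmin_r | auto].
Qed.

(** * The maximal even solutions *)

(** Evenness of [y] is not imposed: it follows from the two initial conditions,
    by uniqueness and invariance under [X -> - X]. *)
Definition even_solution (M H c b : R) (y z : R -> R) : Prop :=
  trajectory M H (fun x => - b < x < b) y z /\ y 0 = c /\ z 0 = 0.

Lemma truncated_even_solution (M H c s0 K b : R) (Y Z : R -> R) :
  0 < M -> - (2 * M) < s0 -> b <= K -> 0 <= K -> Y 0 = c -> Z 0 = 0 ->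
  (forall x, is_derive Y x (velocity x (Y x) (Z x)) /\
             is_derive Z x (truncated_force M H s0 (K + 2 * M + 1) x (Y x) (Z x))) ->
  (forall x, - b < x < b -> s0 < x ^ 2 - Y x ^ 2) ->
  even_solution M H c b Y Z.
Proof.
  intros HM H0 HbK HK Y0 Z0 Sol G. split; [|split]; trivial. intros x Hx.
  assert (Gx := G x Hx).
  assert (Rg : kruskal_region M (Y x) x) by (unfold kruskal_region; lra).
  assert (Sp : -1 < Z x < 1).
  { apply (truncated_spacelike M H s0 (K + 2 * M + 1) Y Z); trivial. lra. }
  assert (By : - (K + 2 * M + 1) <= Y x <= K + 2 * M + 1)
    by (apply (kruskal_region_bound M (Y x) x); trivial; lra).
  destruct (Sol x) as (A & B). repeat split; trivial; try lra.
  - apply is_derive_D_in. unfold velocity in A. now rewrite clamp_id in A by lra.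
  - apply (is_derive_D_in Z (fun s => acceleration M H s (Y s) (Z s))).
    unfold truncated_force in B. rewrite !clamp_id in B by lra.
    rewrite Rmax_right in B by lra. exact B.
Qed.

(** The leaf of height [c] is the union of all these solutions, which agree
    wherever they are both defined. *)
Definition leaf_domain (M H c x : R) : Prop :=
  exists b y z, - b < x < b /\ even_solution M H c b y z.

Definition leaf_height (M H c x : R) : R :=
  epsilon (inhabits 0)
    (fun t => exists b y z, - b < x < b /\ even_solution M H c b y z /\ y x = t).

Definition leaf_slope (M H c x : R) : R :=
  epsilon (inhabits 0)
    (fun p => exists b y z, - b < x < b /\ even_solution M H c b y z /\ z x = p).

Lemma even_solution_unique M H c b1 y1 z1 b2 y2 z2 x : 0 < M ->
  even_solution M H c b1 y1 z1 -> even_solution M H c b2 y2 z2 ->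
  - b1 < x < b1 -> - b2 < x < b2 -> y1 x = y2 x /\ z1 x = z2 x.
Proof.
  intros HM (T1 & A1 & B1) (T2 & A2 & B2) H1 H2.
  apply (trajectory_unique M H (fun s => (- b1 < s < b1) /\ (- b2 < s < b2)) y1 z1 y2 z2 0 x);
    try lra.
  - intros u v w Hu Hw Hv. lra.
  - now apply (trajectory_restrict _ _ (fun s => - b1 < s < b1)).
  - now apply (trajectory_restrict _ _ (fun s => - b2 < s < b2)).
Qed.

Lemma even_solution_leaf M H c b y z x : 0 < M ->
  even_solution M H c b y z -> - b < x < b ->
  leaf_height M H c x = y x /\ leaf_slope M H c x = z x.
Proof.
  intros HM S Hx. split.
  - unfold leaf_height. match goal with |- epsilon ?i ?P = _ =>
      destruct (epsilon_spec i P) as (b' & y' & z' & Hx' & S' & <-) end.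
    { exists (y x), b, y, z. auto. }
    now apply (even_solution_unique M H c b' y' z' b y z).
  - unfold leaf_slope. match goal with |- epsilon ?i ?P = _ =>
      destruct (epsilon_spec i P) as (b' & y' & z' & Hx' & S' & <-) end.
    { exists (z x), b, y, z. auto. }
    now apply (even_solution_unique M H c b' y' z' b y z).
Qed.

Lemma leaf_trajectory M H c : 0 < M ->
  trajectory M H (leaf_domain M H c) (leaf_height M H c) (leaf_slope M H c).
Proof.
  intros HM x (b & y & z & Hx & S).
  destruct (even_solution_leaf M H c b y z x HM S Hx) as (Ey & Ez).
  destruct (proj1 S x Hx) as (A & B & C & E). rewrite Ey, Ez.
  assert (Near : exists del, 0 < del /\ forall s, Rabs (s - x) < del -> - b < s < b).
  { exists (Rmin (b - x) (x + b)). split; [apply Rmin_glb_lt; lra|]. intros s Hs.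
    assert (Hs1 := Rlt_le_trans _ _ _ Hs (Rmin_l _ _)).
    assert (Hs2 := Rlt_le_trans _ _ _ Hs (Rmin_r _ _)).
    apply Rabs_def2 in Hs1. apply Rabs_def2 in Hs2. lra. }
  destruct Near as (del & Hd & Near).
  split; [|split; [|split]]; trivial.
  - apply (D_in_local _ _ _ _ _ _ _ C); trivial. exists del. split; trivial.
    intros s _ Hs. split; auto. now apply (even_solution_leaf M H c b y z s HM S), Near.
  - apply (D_in_local _ _ _ _ _ _ _ E); trivial; [now rewrite Ey, Ez|].
    exists del. split; trivial.
    intros s _ Hs. split; auto. now apply (even_solution_leaf M H c b y z s HM S), Near.
Qed.

Lemma leaf_domain_le M H c x x' :
  leaf_domain M H c x -> Rabs x' <= Rabs x -> leaf_domain M H c x'.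
Proof.
  intros (b & y & z & Hx & S) L. exists b, y, z. split; trivial.
  assert (A : Rabs x < b) by (apply Rabs_def1; lra).
  assert (B : Rabs x' < b) by lra. apply Rabs_def2 in B. lra.
Qed.

Lemma leaf_domain_convex M H c : convex (leaf_domain M H c).
Proof.
  intros x y z Dx Dz Hy. destruct (Rle_dec 0 y).
  - apply (leaf_domain_le _ _ _ z); trivial. rewrite !Rabs_pos_eq; lra.
  - apply (leaf_domain_le _ _ _ x); trivial. rewrite <- Rabs_Ropp, <- (Rabs_Ropp x), !Rabs_pos_eq; lra.
Qed.

Lemma leaf_domain_0 M H c x : leaf_domain M H c x -> leaf_domain M H c 0.
Proof.
  intros D. apply (leaf_domain_le _ _ _ _ _ D). rewrite Rabs_R0. apply Rabs_pos.
Qed.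

Lemma leaf_at_0 M H c x : 0 < M -> leaf_domain M H c x ->
  leaf_height M H c 0 = c /\ leaf_slope M H c 0 = 0.
Proof.
  intros HM D. destruct (leaf_domain_0 _ _ _ _ D) as (b & y & z & Hx & S).
  destruct (even_solution_leaf M H c b y z 0 HM S Hx) as (-> & ->). apply S.
Qed.

Lemma leaf_region_0 M H c x : 0 < M -> leaf_domain M H c x -> kruskal_region M c 0.
Proof.
  intros HM D. destruct (leaf_trajectory M H c HM 0) as (A & _).
  - eapply leaf_domain_0; eauto.
  - now rewrite (proj1 (leaf_at_0 M H c x HM D)) in A.
Qed.

Lemma leaf_even M H c x : 0 < M -> leaf_domain M H c x ->
  leaf_domain M H c (- x) /\ leaf_height M H c (- x) = leaf_height M H c x.
Proof.
  intros HM (b & y & z & Hx & S). split.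
  - exists b, y, z. split; trivial. lra.
  - assert (S' : even_solution M H c b (fun s => y (- s)) (fun s => - z (- s))).
    { destruct S as (T & A & B). split; [|split].
      - apply (trajectory_restrict _ _ (fun s => - b < - s < b)); [intros; lra|].
        exact (trajectory_opp _ _ _ _ _ T).
      - now rewrite Ropp_0.
      - rewrite Ropp_0, B. ring. }
    rewrite (proj1 (even_solution_leaf M H c b _ _ x HM S' Hx)).
    apply (even_solution_leaf M H c b y z); trivial. lra.
Qed.

(** The truncated solution starts in [s > s0], so for a while it solves the
    SS-CMC equation itself. *)
Lemma leaf_domain_start M H c : 0 < M -> kruskal_region M c 0 -> leaf_domain M H c 0.
Proof.
  intros HM HR. unfold kruskal_region in HR.
  set (s0 := (- c ^ 2 - 2 * M) / 2). assert (Hs : - (2 * M) < s0) by (unfold s0; lra).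
  destruct (truncated_solution M H s0 (1 + 2 * M + 1) c 0) as (Y & Z & Y0 & Z0 & Sol); trivial.
  { lra. }
  assert (C : continuity_pt (fun x => x * x - Y x * Y x) 0).
  { assert (CY : continuity_pt Y 0) by (eapply is_derive_continuity_pt; apply Sol).
    apply continuity_pt_minus; apply continuity_pt_mult; trivial;
      apply derivable_continuous_pt, derivable_pt_id. }
  destruct (proj1 (continuity_pt_iff _ _) C (- c ^ 2 - s0)) as (del & Hd & L).
  { unfold s0. lra. }
  exists (Rmin del 1), Y, Z. assert (0 < Rmin del 1) by (apply Rmin_glb_lt; lra).
  split; [lra|].
  apply (truncated_even_solution M H c s0 1); trivial; try lra.
  - apply Rmin_r.
  - intros x Hx. assert (A := Rmin_l del 1).
    assert (B := L x). cbv beta in B. rewrite Y0, Rminus_0_r in B.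
    assert (Rabs x < del) by (apply Rabs_def1; lra).
    apply B, Rabs_def2 in H1. lra.
Qed.

Lemma trajectory_lipschitz M H D y z a b :
  convex D -> trajectory M H D y z -> D a -> D b -> a <= b ->
  Rabs (y b - y a) <= b - a.
Proof.
  intros CD T Da Db Hab.
  destruct (D_in_mvt y z D a b Hab) as (c & Hc & ->).
  { intros x Hx. assert (Dx : D x) by now apply (CD a x b). split; trivial. now apply T. }
  destruct (T c) as (_ & Sp & _); [now apply (CD a c b)|].
  apply Rabs_le_between. split; nra.
Qed.

(** The limit is the least upper bound of [f x - (beta - x)]. *)
Lemma lipschitz_limit_left f beta : 0 < beta ->
  (forall x y, 0 <= x < beta -> 0 <= y < beta -> Rabs (f x - f y) <= Rabs (x - y)) ->
  exists l, forall x, 0 <= x < beta -> Rabs (f x - l) <= beta - x.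
Proof.
  intros Hb L.
  assert (B : forall x y, 0 <= x < beta -> 0 <= y < beta ->
            f x - (beta - x) <= f y + (beta - y)).
  { intros x y Hx Hy. assert (A := L x y Hx Hy). apply Rabs_le_between in A.
    assert (Rabs (x - y) <= (beta - x) + (beta - y)) by (apply Rabs_le_between; lra). lra. }
  destruct (completeness (fun r => exists x, 0 <= x < beta /\ r = f x - (beta - x)))
    as (l & U & Lst).
  - exists (f 0 + (beta - 0)). intros r (x & Hx & ->). apply B; lra.
  - exists (f 0 - (beta - 0)), 0. lra.
  - exists l. intros x Hx. apply Rabs_le_between.
    assert (f x - (beta - x) <= l) by (apply U; eauto).
    assert (l <= f x + (beta - x)) by (apply Lst; intros r (y & Hy & ->); auto). lra.
Qed.

Lemma leaf_domain_bounded M H c x :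
  leaf_domain M H c 0 -> ~ leaf_domain M H c x ->
  exists beta, 0 < beta /\ forall y, leaf_domain M H c y <-> - beta < y < beta.
Proof.
  intros D0 Dx.
  assert (Open : forall y, leaf_domain M H c y ->
            exists b, Rabs y < b /\ leaf_domain M H c b).
  { intros y (b & u & v & Hy & S).
    assert (A : Rabs y < b) by (apply Rabs_def1; lra).
    assert (P := Rabs_pos y).
    exists ((Rabs y + b) / 2). split; [lra|]. exists b, u, v. split; trivial. lra. }
  destruct (completeness (leaf_domain M H c)) as (beta & U & L).
  - exists (Rabs x). intros y Dy. destruct (Rle_dec y (Rabs x)); trivial. exfalso. apply Dx.
    apply (leaf_domain_le M H c y); trivial. assert (A := Rle_abs y). lra.
  - now exists 0.
  - exists beta.
    assert (In : forall y, leaf_domain M H c y -> Rabs y < beta).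
    { intros y Dy. destruct (Open y Dy) as (b & Hb & Db). apply U in Db. lra. }
    split.
    + apply In in D0. now rewrite Rabs_R0 in D0.
    + intros y. split.
      * intros Dy. apply In, Rabs_def2 in Dy. lra.
      * intros Hy. destruct (classic (leaf_domain M H c y)) as [|n]; trivial. exfalso.
        assert (beta <= Rabs y).
        { apply L. intros b Db. destruct (Rle_dec b (Rabs y)); trivial. exfalso. apply n.
          apply (leaf_domain_le M H c b); trivial. assert (A := Rle_abs b). lra. }
        assert (Rabs y < beta) by (apply Rabs_def1; lra). lra.
Qed.

(** If the endpoint were a regular point, the leaf would stay in a region
    [s >= s1 > - 2 * M], where it follows a solution of the truncated equation;
    that one exists globally and prolongs the leaf. *)
Lemma leaf_end M H c beta : 0 < M -> 0 < beta ->
  (forall y, leaf_domain M H c y <-> - beta < y < beta) ->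
  exists l, (forall x, 0 <= x < beta -> Rabs (leaf_height M H c x - l) <= beta - x) /\
            ~ kruskal_region M l beta.
Proof.
  intros HM Hb Dom. set (h := leaf_height M H c).
  assert (T := leaf_trajectory M H c HM). fold h in T.
  destruct (lipschitz_limit_left h beta Hb) as (l & Hl).
  { assert (Ord : forall x y, 0 <= x < beta -> 0 <= y < beta -> x <= y ->
              Rabs (h x - h y) <= Rabs (x - y)).
    { intros x y Hx Hy Hxy. rewrite Rabs_minus_sym, (Rabs_minus_sym x), (Rabs_pos_eq (y - x)) by lra.
      apply (trajectory_lipschitz M H (leaf_domain M H c) h (leaf_slope M H c)); trivial.
      - apply leaf_domain_convex.
      - apply Dom; lra.
      - apply Dom; lra. }
    intros x y Hx Hy. destruct (Rle_dec x y); auto.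
    rewrite Rabs_minus_sym, (Rabs_minus_sym x). apply Ord; lra. }
  exists l. split; trivial. intros Rl.
  (* The leaf together with its end is continuous on a compact interval. *)
  set (y := fun x => if Rlt_dec x beta then h x else l).
  destruct (compact_gap M y (fun x => 0 <= x <= beta) 0 beta) as (s1 & Hs1 & Gap); [lra| |].
  { intros x Hx. split; trivial. split.
    - apply continue_in_iff. intros eps He. unfold y. destruct (Rlt_dec x beta) as [h1|h1].
      + assert (Dx : leaf_domain M H c x) by (apply Dom; lra).
        destruct (proj1 (continue_in_iff _ _ _) (trajectory_continue _ _ _ _ _ _ T Dx) eps He)
          as (alp & Ha & K).
        exists (Rmin alp (beta - x)). split; [apply Rmin_glb_lt; lra|]. intros s Hs A.
        assert (A1 := Rlt_le_trans _ _ _ A (Rmin_l _ _)).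
        assert (A2 := Rlt_le_trans _ _ _ A (Rmin_r _ _)). apply Rabs_def2 in A2.
        destruct (Rlt_dec s beta) as [h2|h2]; [|lra].
        apply K; trivial. apply Dom; lra.
      + exists eps. split; trivial. intros s Hs A.
        destruct (Rlt_dec s beta) as [h2|h2].
        * eapply Rle_lt_trans; [apply Hl; lra|]. apply Rabs_def2 in A. lra.
        * rewrite Rminus_diag, Rabs_R0. trivial.
    - unfold y. destruct (Rlt_dec x beta) as [h1|h1].
      + apply T, Dom. lra.
      + now replace x with beta by lra. }
  assert (GapLeaf : forall x, - beta < x < beta -> s1 <= x ^ 2 - h x ^ 2).
  { assert (Pos : forall x, 0 <= x < beta -> s1 <= x ^ 2 - h x ^ 2).
    { intros x Hx. assert (A := Gap x). unfold y in A.
      destruct (Rlt_dec x beta); [apply A|]; lra. }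
    intros x Hx. destruct (Rle_dec 0 x) as [p|p]; [apply Pos; lra|].
    assert (Dx : leaf_domain M H c x) by (apply Dom; lra).
    assert (A := Pos (- x)). unfold h in A. rewrite (proj2 (leaf_even M H c x HM Dx)) in A.
    fold h in A. replace ((- x) ^ 2) with (x ^ 2) in A by ring. apply A. lra. }
  set (s0 := (s1 - 2 * M) / 2). assert (Hs0 : - (2 * M) < s0) by (unfold s0; lra).
  set (K := beta + 1).
  destruct (truncated_solution M H s0 (K + 2 * M + 1) c 0) as (Y & Z & Y0 & Z0 & Sol); trivial.
  { unfold K; lra. }
  assert (D0 : leaf_domain M H c 0) by (apply Dom; lra).
  destruct (leaf_at_0 M H c 0 HM D0) as (h0 & p0).
  assert (Eq : forall x, - beta < x < beta -> h x = Y x).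
  { intros x Hx.
    apply (truncated_unique M H s0 (K + 2 * M + 1) (fun x => - beta < x < beta)
             h (leaf_slope M H c) Y Z 0 x); trivial.
    - unfold K; lra.
    - intros u v w Hu Hw Hv. lra.
    - apply trajectory_truncated; trivial.
      + apply (trajectory_restrict _ _ (leaf_domain M H c)); trivial. intros; now apply Dom.
      + intros s Hs. split; [unfold K; lra|]. eapply Rle_trans; [|now apply GapLeaf].
        unfold s0; lra.
    - intros s _. destruct (Sol s) as (A & B). split.
      + now apply (is_derive_D_in Y (fun s => velocity s (Y s) (Z s))).
      + now apply (is_derive_D_in Z
          (fun s => truncated_force M H s0 (K + 2 * M + 1) s (Y s) (Z s))).
    - lra.
    - unfold h. lra.
    - lra. }
  assert (CW : continuity (fun x => x * x - Y x * Y x)).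
  { intros x. assert (CY : continuity_pt Y x) by (eapply is_derive_continuity_pt; apply Sol).
    apply continuity_pt_minus; apply continuity_pt_mult; trivial;
      apply derivable_continuous_pt, derivable_pt_id. }
  (* [s1] bounds s on the open interval, so [s > s0] persists past each end. *)
  assert (Past : forall e, e = beta \/ e = - beta ->
            exists del, 0 < del /\ forall x, Rabs (x - e) < del -> s0 < x * x - Y x * Y x).
  { intros e He.
    destruct (proj1 (continuity_pt_iff _ _) (CW e) ((s1 - s0) / 2)) as (del & Hd & L).
    { unfold s0; lra. }
    assert (m0 : 0 < Rmin del beta) by (apply Rmin_glb_lt; lra).
    assert (m1 := Rmin_l del beta). assert (m2 := Rmin_r del beta).
    set (m := Rmin del beta) in *.
    assert (Ex : exists x, - beta < x < beta /\ Rabs (x - e) < del).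
    { destruct He as [-> | ->].
      - exists (beta - m / 2). split; [lra|]. apply Rabs_def1; lra.
      - exists (- beta + m / 2). split; [lra|]. apply Rabs_def1; lra. }
    destruct Ex as (x & Hx & Lx). apply L, Rabs_def2 in Lx.
    assert (A := GapLeaf x Hx). rewrite (Eq x Hx) in A.
    exists del. split; trivial. intros u Hu. apply L, Rabs_def2 in Hu.
    unfold s0 in *. simpl in A. lra. }
  destruct (Past beta) as (d1 & Hd1 & P1); [now left|].
  destruct (Past (- beta)) as (d2 & Hd2 & P2); [now right|].
  set (d := Rmin (Rmin d1 d2) 1).
  assert (Hd : 0 < d) by (repeat apply Rmin_glb_lt; lra).
  assert (L1 : d <= d1) by (eapply Rle_trans; [apply Rmin_l | apply Rmin_l]).
  assert (L2 : d <= d2) by (eapply Rle_trans; [apply Rmin_l | apply Rmin_r]).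
  assert (L3 : d <= 1) by apply Rmin_r.
  assert (Db : leaf_domain M H c beta).
  { exists (beta + d), Y, Z. split; [lra|].
    apply (truncated_even_solution M H c s0 K); trivial; try (unfold K; lra).
    intros x Hx. destruct (Rlt_dec (- beta) x); [destruct (Rlt_dec x beta)|].
    - assert (A := GapLeaf x). rewrite (Eq x) in A by lra. unfold s0. lra.
    - assert (A := P1 x). assert (Rabs (x - beta) < d1) by (apply Rabs_def1; lra).
      simpl. lra.
    - assert (A := P2 x). assert (Rabs (x - - beta) < d2) by (apply Rabs_def1; lra).
      simpl. lra. }
  apply Dom in Db. lra.
Qed.

(** A curve that coincides with a leaf up to the end of that leaf has the end of
    the leaf as its limit there, which is a singular point. *)
Lemma leaf_end_unreachable M H c beta (D : R -> Prop) G x1 :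
  0 < M -> 0 < beta -> (forall y, leaf_domain M H c y <-> - beta < y < beta) ->
  convex D -> D x1 -> x1 < beta -> D beta -> continue_in G D beta ->
  kruskal_region M (G beta) beta ->
  ~ (forall x, D x -> leaf_domain M H c x -> G x = leaf_height M H c x).
Proof.
  intros HM Hb Dom CD D1 H1 Db C Rg Agree.
  destruct (leaf_end M H c beta HM Hb Dom) as (l & Hl & Nl). apply Nl.
  replace l with (G beta); trivial.
  destruct (Req_dec (G beta) l) as [|n]; trivial. exfalso.
  assert (He : 0 < Rabs (G beta - l)) by (apply Rabs_pos_lt; lra).
  set (eps := Rabs (G beta - l)) in *.
  destruct (proj1 (continue_in_iff _ _ _) C (eps / 2)) as (alp & Ha & K); [lra|].
  set (m := Rmax (Rmax x1 0) (beta - Rmin (alp / 2) (eps / 2))).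
  assert (mb : m < beta).
  { repeat apply Rmax_lub_lt; trivial. assert (0 < Rmin (alp / 2) (eps / 2)).
    { apply Rmin_glb_lt; lra. } lra. }
  assert (m1 : x1 <= m) by (eapply Rle_trans; [apply (Rmax_l x1 0) | apply Rmax_l]).
  assert (m2 : 0 <= m) by (eapply Rle_trans; [apply (Rmax_r x1 0) | apply Rmax_l]).
  assert (m3 : beta - Rmin (alp / 2) (eps / 2) <= m) by apply Rmax_r.
  assert (m4 := Rmin_l (alp / 2) (eps / 2)). assert (m5 := Rmin_r (alp / 2) (eps / 2)).
  assert (Dm : D m) by (apply (CD x1 m beta); trivial; lra).
  assert (A := K m Dm). rewrite (Agree m Dm) in A by (apply Dom; lra).
  assert (B := Hl m). assert (Rabs (m - beta) < alp) by (apply Rabs_def1; lra).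
  assert (A' : Rabs (leaf_height M H c m - G beta) < eps / 2) by auto.
  assert (B' : Rabs (leaf_height M H c m - l) <= eps / 2)
    by (eapply Rle_trans; [apply B; lra | lra]).
  assert (Q : eps <= Rabs (leaf_height M H c m - l) + Rabs (leaf_height M H c m - G beta)).
  { unfold eps. replace (G beta - l)
      with ((leaf_height M H c m - l) + - (leaf_height M H c m - G beta)) by ring.
    eapply Rle_trans; [apply Rabs_triang|]. rewrite Rabs_Ropp. lra. }
  lra.
Qed.

(** The solution agrees with the leaf by uniqueness, and it cannot outlive the
    leaf, which ends at the singularity if it ends at all. *)
Lemma tangent_solution_in_leaf M H c (D : R -> Prop) G P x1 x :
  0 < M -> convex D -> trajectory M H D G P -> D x1 -> leaf_domain M H c x1 ->
  G x1 = leaf_height M H c x1 -> P x1 = leaf_slope M H c x1 -> D x ->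
  leaf_domain M H c x /\ G x = leaf_height M H c x.
Proof.
  intros HM CD T D1 L1 EG EP Dx.
  assert (Agree : forall s, D s -> leaf_domain M H c s -> G s = leaf_height M H c s).
  { intros s Ds Ls.
    apply (trajectory_unique M H (fun s => D s /\ leaf_domain M H c s)
             G P (leaf_height M H c) (leaf_slope M H c) x1 s); auto.
    - intros u v w (Hu & Hu') (Hw & Hw') Hv. split; [now apply (CD u v w)|].
      now apply (leaf_domain_convex M H c u v w).
    - apply (trajectory_restrict _ _ D); trivial. now intros s' [].
    - apply (trajectory_restrict _ _ (leaf_domain M H c)); [now intros s' []|].
      now apply leaf_trajectory. }
  destruct (classic (leaf_domain M H c x)) as [Lx|Lx]; [auto|]. exfalso.
  destruct (leaf_domain_bounded M H c x) as (beta & Hb & Dom); trivial.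
  { eapply leaf_domain_0; eauto. }
  assert (B1 := proj1 (Dom x1) L1). rewrite Dom in Lx.
  destruct (Rle_dec beta x) as [h|h].
  - assert (Db : D beta) by (apply (CD x1 beta x); trivial; lra).
    apply (leaf_end_unreachable M H c beta D G x1); trivial; try lra.
    + now apply (trajectory_continue M H D G P).
    + now apply T.
  - assert (Db : D (- beta)) by (apply (CD x (- beta) x1); trivial; lra).
    assert (T' := trajectory_opp _ _ _ _ _ T).
    apply (leaf_end_unreachable M H c beta (fun s => D (- s)) (fun s => G (- s)) (- x1));
      trivial; try lra.
    + now apply convex_opp.
    + now rewrite Ropp_involutive.
    + apply (trajectory_continue _ _ _ _ _ _ T' Db).
    + apply (T' _ Db).
    + intros s Ds Ls. destruct (leaf_even M H c s HM Ls) as (Ls' & <-). auto.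
Qed.

(** * The family of T-axisymmetric hypersurfaces *)

Lemma leaf_ss_cmc M H c : 0 < M -> kruskal_region M c 0 ->
  ss_cmc M H (leaf_domain M H c) (leaf_height M H c).
Proof.
  intros HM Rg. apply ss_cmc_iff. split; [|exists (leaf_slope M H c); now apply leaf_trajectory].
  split; [apply leaf_domain_convex|].
  destruct (leaf_domain_start M H c HM Rg) as (b & y & z & Hb & S).
  exists 0, (b / 2). repeat split; [| |lra]; exists b, y, z; split; trivial; lra.
Qed.

Lemma leaf_ss_cmc_closed M H c X0 : 0 < M -> 0 < X0 -> leaf_domain M H c X0 ->
  ss_cmc M H (closed_interval (- X0) X0) (leaf_height M H c).
Proof.
  intros HM HX D. apply ss_cmc_iff. split.
  - split; [unfold closed_interval; intros; lra|].
    exists (- X0), X0. unfold closed_interval. lra.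
  - exists (leaf_slope M H c).
    apply (trajectory_restrict _ _ (leaf_domain M H c)); [|now apply leaf_trajectory].
    intros x Hx. apply (leaf_domain_le M H c X0); trivial.
    unfold closed_interval in Hx. rewrite (Rabs_pos_eq X0) by lra. apply Rabs_le_between. lra.
Qed.

Lemma ss_cmc_opp M H D F : ss_cmc M H D F ->
  ss_cmc M H (fun x => D (- x)) (fun x => F (- x)).
Proof.
  rewrite !ss_cmc_iff. intros ((CD & x & y & Dx & Dy & L) & P & T). split.
  - split; [now apply convex_opp|]. exists (- y), (- x). rewrite !Ropp_involutive.
    repeat split; trivial; lra.
  - exists (fun x => - P (- x)). now apply trajectory_opp.
Qed.

(** Both [P 0] and [- P 0] are derivatives of [F] at [0]. *)
Lemma T_axisymmetric_slope M H (D : R -> Prop) F P del :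
  trajectory M H D F P -> 0 < del -> (forall x, - del <= x <= del -> D x) ->
  T_axisymmetric D F -> P 0 = 0.
Proof.
  intros T Hd HD Ev.
  assert (D0 : D 0) by (apply HD; lra).
  assert (A : derivable_pt_lim F 0 (P 0)).
  { apply (D_in_interior F P D (- del) del); trivial; [lra|]. now apply T. }
  assert (B : derivable_pt_lim F 0 (- P (- 0))).
  { assert (B := D_in_opp F P D 0). rewrite Ropp_0 in B at 1.
    assert (B' := B (proj1 (proj2 (proj2 (T 0 D0))))).
    assert (C := D_in_local _ F _ (fun y => - P (- y)) _ D 0 B').
    apply (D_in_interior F (fun y => - P (- y)) D (- del) del); trivial; [lra|].
    apply C; trivial.
    - now rewrite Ropp_0.
    - exists 1. split; [lra|]. intros y Dy _. split; [now apply Ev | symmetry; now apply Ev]. }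
  assert (E := uniqueness_limite _ _ _ _ A B). rewrite Ropp_0 in E. lra.
Qed.

Lemma T_axisymmetric_in_leaf M H D F x : 0 < M ->
  ss_cmc M H D F -> T_axisymmetric D F -> D x ->
  D 0 /\ leaf_domain M H (F 0) x /\ F x = leaf_height M H (F 0) x.
Proof.
  intros HM SF Ev Dx. apply ss_cmc_iff in SF.
  destruct SF as ((CD & a & b & Da & Db & Lab) & P & T).
  assert (Nbh : exists del, 0 < del /\ forall x, - del <= x <= del -> D x).
  { assert (Sym : forall a, 0 < a -> D a -> exists del, 0 < del /\ forall x, - del <= x <= del -> D x).
    { intros e He De. exists e. split; trivial. intros s Hs.
      apply (CD (- e) s e); trivial. now apply Ev. }
    destruct (Rlt_dec 0 b) as [h|h]; [now apply (Sym b)|].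
    apply (Sym (- a)); [lra | now apply Ev]. }
  destruct Nbh as (del & Hd & Nbh).
  assert (D0 : D 0) by (apply Nbh; lra). split; trivial.
  assert (P0 : P 0 = 0) by now apply (T_axisymmetric_slope M H D F P del).
  assert (Rg : kruskal_region M (F 0) 0) by now apply T.
  assert (L0 := leaf_domain_start M H _ HM Rg).
  destruct (leaf_at_0 M H _ _ HM L0) as (h0 & p0).
  apply (tangent_solution_in_leaf M H (F 0) D F P 0 x); trivial; lra.
Qed.

(** An extension still starts horizontally at height [c], hence lies in the leaf. *)
Lemma leaf_maximally_extended M H c : 0 < M -> kruskal_region M c 0 ->
  maximally_extended M H (leaf_domain M H c) (leaf_height M H c).
Proof.
  intros HM Rg D' G SG Ext x Dx. apply ss_cmc_iff in SG.
  destruct SG as ((CD & _) & P & T).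
  assert (L0 := leaf_domain_start M H c HM Rg). destruct (Ext 0 L0) as (D0 & G0).
  destruct (leaf_at_0 M H c 0 HM L0) as (h0 & p0).
  apply (tangent_solution_in_leaf M H c D' G P 0 x); trivial. rewrite p0.
  destruct L0 as (b & y & z & Hb & S).
  apply (T_axisymmetric_slope M H (leaf_domain M H c) G P (b / 2)); [|lra| |].
  - intros s Ds. destruct (Ext s Ds) as (Ds' & Es).
    destruct (T s Ds') as (A & B & C & E).
    assert (Sub : forall u, leaf_domain M H c u -> D' u) by (intros; now apply Ext).
    repeat split; trivial; try lra.
    + exact (D_in_imp _ _ _ _ _ Sub C).
    + exact (D_in_imp _ _ _ _ _ Sub E).
  - intros s Hs. exists b, y, z. split; trivial. lra.
  - intros s Ds. destruct (leaf_even M H c s HM Ds) as (Ds' & Es). split; trivial.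
    rewrite (proj2 (Ext _ Ds')), (proj2 (Ext _ Ds)). trivial.
Qed.

(** Tangency at [X = 0] puts a member of the family into the leaf of the same
    height there, and its maximality makes it the whole leaf. *)
Lemma tss_cmc_family_iff M H S : 0 < M ->
  (tss_cmc_family M H S <->
   exists c, kruskal_region M c 0 /\
     Same_set event S (hypersurface (leaf_domain M H c) (leaf_height M H c))).
Proof.
  intros HM. split.
  - intros (D & F & SF & Ev & Max & Same).
    assert (Lf := fun x => T_axisymmetric_in_leaf M H D F x HM SF Ev).
    assert (NE : exists x, D x) by (destruct SF as ((_ & x & _ & Dx & _) & _); eauto).
    destruct NE as (x0 & Dx0). destruct (Lf x0 Dx0) as (D0 & L0 & _).
    assert (Rg : kruskal_region M (F 0) 0) by now apply SF.
    exists (F 0). split; trivial.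
    assert (DD : forall x, leaf_domain M H (F 0) x -> D x).
    { apply (Max _ (leaf_height M H (F 0))); [now apply leaf_ss_cmc|].
      intros x Dx. destruct (Lf x Dx) as (_ & A & B). auto. }
    destruct Same as (I1 & I2). split.
    + intros ((t & x) & n) HS. apply I1 in HS. destruct HS as (Dx & ->).
      destruct (Lf x Dx) as (_ & A & B). now split.
    + intros ((t & x) & n) (Lx & ->). apply I2. assert (Dx := DD x Lx).
      split; trivial. symmetry. now apply Lf.
  - intros (c & Rg & Same). exists (leaf_domain M H c), (leaf_height M H c).
    split; [now apply leaf_ss_cmc|]. split; [|split; trivial].
    + intros x Dx. now apply leaf_even.
    + now apply leaf_maximally_extended.
Qed.

Definition leaves_cover (M H : R) : Prop :=
  forall T X, kruskal_region M T X ->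
    exists c, leaf_domain M H c X /\ leaf_height M H c X = T.

Definition leaves_disjoint (M H : R) : Prop :=
  forall c1 c2 X, leaf_domain M H c1 X -> leaf_domain M H c2 X ->
    leaf_height M H c1 X = leaf_height M H c2 X -> c1 = c2.

Definition pole : sphere.
Proof. exists (1, 0, 0). simpl. ring. Defined.

Lemma foliates_iff M H : 0 < M ->
  (foliates (tss_cmc_family M H) (kruskal_extension M) <->
   leaves_cover M H /\ leaves_disjoint M H).
Proof.
  intros HM. set (leaf := fun c => hypersurface (leaf_domain M H c) (leaf_height M H c)).
  assert (Fam : forall c, kruskal_region M c 0 -> tss_cmc_family M H (leaf c)).
  { intros c Rg. apply tss_cmc_family_iff; trivial. exists c. split; trivial. split; now intros e. }
  split.
  - intros (_ & Cov & Dis). split.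
    + intros T X Rg. destruct (Cov (T, X, pole) Rg) as (S & FS & HS).
      apply tss_cmc_family_iff in FS; trivial. destruct FS as (c & _ & I & _).
      apply I in HS. destruct HS as (D & E). eauto.
    + intros c1 c2 X D1 D2 E. destruct (Req_dec c1 c2) as [|n]; trivial. exfalso.
      destruct (Dis (leaf c1) (leaf c2)) as (Dj).
      * apply Fam. eapply leaf_region_0; eauto.
      * apply Fam. eapply leaf_region_0; eauto.
      * intros (I & _). destruct (leaf_at_0 M H c1 X HM D1) as (h1 & _).
        destruct (leaf_at_0 M H c2 X HM D2) as (h2 & _).
        assert (A : In event (leaf c1) (c1, 0, pole)).
        { split; auto. eapply leaf_domain_0; eauto. }
        apply I in A. destruct A as (_ & A). lra.
      * apply (Dj (leaf_height M H c1 X, X, pole)). now split; split.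
  - intros (Cov & Dis). split; [|split].
    + intros S (D & F & SF & _ & _ & I & _) ((T & X) & n) HS.
      apply I in HS. destruct HS as (DX & ->). now apply SF.
    + intros ((T & X) & n) Rg. destruct (Cov T X Rg) as (c & D & E). exists (leaf c). split.
      * apply Fam. eapply leaf_region_0; eauto.
      * now split.
    + intros S1 S2 F1 F2 NS. apply tss_cmc_family_iff in F1, F2; trivial.
      destruct F1 as (c1 & _ & I1 & J1), F2 as (c2 & _ & I2 & J2).
      split. intros ((T & X) & n) HI. apply NS. inversion HI as [e H1 H2]; subst.
      apply I1 in H1. apply I2 in H2. destruct H1 as (D1 & E1), H2 as (D2 & E2).
      assert (c1 = c2) as <- by (apply (Dis c1 c2 X); trivial; congruence).
      split; intros e He; auto.
Qed.

Definition dirichlet_solvable (M H : R) : Prop :=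
  forall T0 X0 : R,
     0 < X0 -> kruskal_region M T0 X0 -> kruskal_region M T0 (- X0) ->
     exists F : R -> R,
       (ss_cmc M H (closed_interval (- X0) X0) F /\
        F X0 = T0 /\ F (- X0) = T0) /\
       (forall G : R -> R,
          ss_cmc M H (closed_interval (- X0) X0) G ->
          G X0 = T0 -> G (- X0) = T0 ->
          forall x, closed_interval (- X0) X0 x -> G x = F x).

Lemma ss_cmc_closed_opp M H X0 F :
  ss_cmc M H (closed_interval (- X0) X0) F ->
  ss_cmc M H (closed_interval (- X0) X0) (fun x => F (- x)).
Proof.
  intros S. apply ss_cmc_opp in S. apply ss_cmc_iff in S. apply ss_cmc_iff.
  destruct S as ((_ & x & y & Dx & Dy & L) & P & T). split.
  - split; [unfold closed_interval; intros; lra|]. exists x, y.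
    unfold closed_interval in *. lra.
  - exists P. apply (trajectory_restrict _ _ (fun x => closed_interval (- X0) X0 (- x))); trivial.
    unfold closed_interval. intros; lra.
Qed.

(** If [F] solves a boundary value problem with equal heights, so does [F (- x)];
    uniqueness makes [F] even, that is, part of a leaf. Two leaves that meet solve
    the same boundary value problem. *)
Lemma dirichlet_imp_foliation M H : 0 < M ->
  dirichlet_solvable M H -> leaves_cover M H /\ leaves_disjoint M H.
Proof.
  intros HM Dir. split.
  - assert (Pos : forall T X, 0 < X -> kruskal_region M T X ->
              exists c, leaf_domain M H c X /\ leaf_height M H c X = T).
    { intros T X HX Rg.
      destruct (Dir T X HX Rg (proj2 (kruskal_region_opp _ _ _) Rg)) as (F & (SF & F1 & F2) & U).
      assert (Ev : T_axisymmetric (closed_interval (- X) X) F).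
      { intros x Dx. split; [unfold closed_interval in *; lra|].
        apply (U (fun x => F (- x))); trivial.
        - now apply ss_cmc_closed_opp.
        - now rewrite Ropp_involutive. }
      destruct (T_axisymmetric_in_leaf M H _ F X HM SF Ev) as (_ & L & E).
      { unfold closed_interval; lra. }
      exists (F 0). split; trivial. lra. }
    intros T X Rg. destruct (Rtotal_order X 0) as [h|[->|h]].
    + destruct (Pos T (- X)) as (c & D & E); [lra | now apply kruskal_region_opp|].
      exists c. destruct (leaf_even M H c (- X) HM D) as (D' & E').
      rewrite Ropp_involutive in D', E'. split; trivial. lra.
    + exists T. assert (D := leaf_domain_start M H T HM Rg). split; trivial.
      now apply (leaf_at_0 M H T 0).
    + now apply Pos.
  - assert (Pos : forall c1 c2 X, 0 < X -> leaf_domain M H c1 X -> leaf_domain M H c2 X ->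
              leaf_height M H c1 X = leaf_height M H c2 X -> c1 = c2).
    { intros c1 c2 X HX D1 D2 E.
      destruct (leaf_even M H c1 X HM D1) as (_ & E1).
      destruct (leaf_even M H c2 X HM D2) as (_ & E2).
      assert (Rg : kruskal_region M (leaf_height M H c1 X) X)
        by now apply (leaf_trajectory M H c1 HM).
      destruct (Dir _ X HX Rg (proj2 (kruskal_region_opp _ _ _) Rg)) as (F & _ & U).
      assert (I0 : closed_interval (- X) X 0) by (unfold closed_interval; lra).
      assert (A1 := U _ (leaf_ss_cmc_closed M H c1 X HM HX D1) eq_refl E1 0 I0).
      assert (A2 := U _ (leaf_ss_cmc_closed M H c2 X HM HX D2) (eq_sym E) (eq_trans E2 (eq_sym E)) 0 I0).
      rewrite (proj1 (leaf_at_0 M H c1 X HM D1)) in A1.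
      rewrite (proj1 (leaf_at_0 M H c2 X HM D2)) in A2. lra. }
    intros c1 c2 X D1 D2 E. destruct (Rtotal_order X 0) as [h|[->|h]].
    + destruct (leaf_even M H c1 X HM D1) as (D1' & E1).
      destruct (leaf_even M H c2 X HM D2) as (D2' & E2).
      apply (Pos c1 c2 (- X)); trivial; lra.
    + destruct (leaf_at_0 M H c1 0 HM D1), (leaf_at_0 M H c2 0 HM D2). lra.
    + now apply (Pos c1 c2 X).
Qed.

(** * The order of the leaves *)

Lemma sign_near a b k : Rabs (b - a) < Rabs a -> a * k > 0 -> b * k > 0.
Proof.
  intros L P. apply Rabs_def2 in L. unfold Rabs in L. destruct (Rcase_abs a); nra.
Qed.

Lemma sign_trans a b k : a * b > 0 -> a * k > 0 -> b * k > 0.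
Proof. intros A B.
  destruct (Rtotal_order a 0) as [h|[->|h]]; [|lra|]; nra. Qed.

(** Leaves that never meet keep the order of their heights at [X = 0], by the
    intermediate value theorem. Products encode both orders at once. *)
Lemma leaf_order M H c1 c2 x : 0 < M -> leaves_disjoint M H ->
  leaf_domain M H c1 x -> leaf_domain M H c2 x -> c1 <> c2 ->
  (leaf_height M H c1 x - leaf_height M H c2 x) * (c1 - c2) > 0.
Proof.
  intros HM Dis.
  assert (Pos : forall x, 0 <= x -> leaf_domain M H c1 x -> leaf_domain M H c2 x -> c1 <> c2 ->
            (leaf_height M H c1 x - leaf_height M H c2 x) * (c1 - c2) > 0).
  { clear x. intros x Hx D1 D2 n.
    destruct (Rgt_dec ((leaf_height M H c1 x - leaf_height M H c2 x) * (c1 - c2)) 0)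
      as [|h]; trivial. exfalso.
    assert (Cl : forall c, leaf_domain M H c x ->
              continuity (fun s => leaf_height M H c (clamp 0 x s))).
    { intros c D. apply (clamp_continuous (leaf_height M H c) (leaf_domain M H c)); trivial.
      intros s Hs. assert (Ds : leaf_domain M H c s).
      { apply (leaf_domain_le M H c x); trivial. rewrite !Rabs_pos_eq; lra. }
      split; trivial. apply (trajectory_continue _ _ _ _ _ _ (leaf_trajectory M H c HM) Ds). }
    assert (C : continuity (fun s => leaf_height M H c1 (clamp 0 x s)
                                   - leaf_height M H c2 (clamp 0 x s)))
      by (apply continuity_minus; auto).
    destruct (IVT_cor _ 0 x C Hx) as (s & Hs & E).
    { rewrite !clamp_id by lra.
      rewrite (proj1 (leaf_at_0 M H c1 x HM D1)), (proj1 (leaf_at_0 M H c2 x HM D2)). lra. }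
    rewrite !clamp_id in E by lra. apply n, (Dis c1 c2 s); [| |lra].
    - apply (leaf_domain_le M H c1 x); trivial. rewrite !Rabs_pos_eq; lra.
    - apply (leaf_domain_le M H c2 x); trivial. rewrite !Rabs_pos_eq; lra. }
  intros D1 D2 n. destruct (Rle_dec 0 x); auto.
  destruct (leaf_even M H c1 x HM D1) as (D1' & <-).
  destruct (leaf_even M H c2 x HM D2) as (D2' & <-). apply Pos; trivial. lra.
Qed.

(** The order of the two leaves before [beta] passes to the limit, and remains
    strict because [l] is singular whereas the other leaf is regular there. *)
Lemma leaf_end_order M H c beta l c' : 0 < M -> leaves_disjoint M H -> 0 < beta ->
  (forall y, leaf_domain M H c y <-> - beta < y < beta) ->
  (forall x, 0 <= x < beta -> Rabs (leaf_height M H c x - l) <= beta - x) ->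
  ~ kruskal_region M l beta -> leaf_domain M H c' beta ->
  (leaf_height M H c' beta - l) * (c' - c) > 0.
Proof.
  intros HM Dis Hb Dom Hl Nl D'.
  assert (n : c' <> c). { intros ->. apply Dom in D'. lra. }
  set (h' := leaf_height M H c') in *. set (a := h' beta - l).
  assert (a0 : a <> 0).
  { intros e. apply Nl. replace l with (h' beta) by (unfold a in e; lra).
    now apply (leaf_trajectory M H c' HM). }
  destruct (Rtotal_order (a * (c' - c)) 0) as [h|[h|h]]; trivial; exfalso.
  - assert (Pa : 0 < Rabs a) by now apply Rabs_pos_lt.
    set (s := Rmax 0 (beta - Rabs a / 4)).
    assert (s1 : 0 <= s) by apply Rmax_l. assert (s2 : beta - Rabs a / 4 <= s) by apply Rmax_r.
    assert (s3 : s < beta) by (apply Rmax_lub_lt; lra).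
    assert (Ds : leaf_domain M H c s) by (apply Dom; lra).
    assert (Ds' : leaf_domain M H c' s).
    { apply (leaf_domain_le M H c' beta); trivial. rewrite !Rabs_pos_eq; lra. }
    assert (Lp : Rabs (h' beta - h' s) <= beta - s).
    { apply (trajectory_lipschitz M H (leaf_domain M H c') h' (leaf_slope M H c')); trivial; try lra.
      - apply leaf_domain_convex.
      - now apply leaf_trajectory. }
    assert (Ls := Hl s (conj s1 s3)).
    assert (O := leaf_order M H c' c s HM Dis Ds' Ds n). fold h' in O.
    assert (N : (h' s - leaf_height M H c s) * - (c' - c) > 0).
    { apply (sign_near a); [|lra].
      replace (h' s - leaf_height M H c s - a)
        with (- (h' beta - h' s) + - (leaf_height M H c s - l)) by (unfold a; ring).
      eapply Rle_lt_trans; [apply Rabs_triang|]. rewrite !Rabs_Ropp. lra. }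
    lra.
  - apply Rmult_integral in h. destruct h; [easy | apply n; lra].
Qed.

(** Continuity of the leaf index along a curve. When the leaf [c] reaches [x0],
    it follows from the continuity of the height of that leaf. The delicate case is
    that of a leaf [c] that ends at the singularity before or at [x0]: the leaves
    that go on then pass its end [l] all on the same side, because the regular
    heights above a given [X] form an interval, which does not contain [l]. *)
Lemma leaf_index_locally M H c c0 (D : R -> Prop) G x0 :
  0 < M -> leaves_disjoint M H -> continue_in G D x0 ->
  leaf_domain M H c0 x0 -> leaf_height M H c0 x0 = G x0 -> c0 <> c ->
  exists del, 0 < del /\ forall x c', D x -> Rabs (x - x0) < del ->
    leaf_domain M H c' x -> leaf_height M H c' x = G x -> (c' - c) * (c0 - c) > 0.
Proof.
  intros HM Dis CG D0 E0 n.
  assert (Conclude : forall x c', leaf_domain M H c x -> leaf_domain M H c' x ->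
            leaf_height M H c' x = G x ->
            (G x - leaf_height M H c x) * (c0 - c) > 0 -> (c' - c) * (c0 - c) > 0).
  { intros x c' Dx Dx' E P. apply (sign_trans (G x - leaf_height M H c x)); trivial.
    rewrite <- E. apply leaf_order; trivial. intros ->. rewrite E in P.
    rewrite Rminus_diag, Rmult_0_l in P. lra. }
  destruct (classic (kruskal_region M c 0)) as [Rg|Rg].
  (* No leaf has index [c]: all indices lie on the same side of [c]. *)
  2:{ exists 1. split; [lra|]. intros x c' _ _ Dx _.
      assert (R0 := leaf_region_0 M H c0 x0 HM D0). assert (R' := leaf_region_0 M H c' x HM Dx).
      unfold kruskal_region in *.
      assert (Q0 : c0 * c0 < c * c) by lra. assert (Q' : c' * c' < c * c) by lra.
      destruct (Rle_dec 0 c).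
      - assert (c0 < c) by nra. assert (c' < c) by nra. nra.
      - assert (c < c0) by nra. assert (c < c') by nra. nra. }
  destruct (classic (leaf_domain M H c x0)) as [Lx0|Lx0].
  - assert (O := leaf_order M H c0 c x0 HM Dis D0 Lx0 n). rewrite E0 in O.
    set (a := G x0 - leaf_height M H c x0) in *.
    assert (Pa : 0 < Rabs a).
    { apply Rabs_pos_lt. intros e. rewrite e, Rmult_0_l in O. lra. }
    destruct (proj1 (continue_in_iff _ _ _) CG (Rabs a / 2)) as (d1 & Hd1 & K1); [lra|].
    assert (CL := trajectory_continue _ _ _ _ _ _ (leaf_trajectory M H c HM) Lx0).
    destruct (proj1 (continue_in_iff _ _ _) CL (Rabs a / 2)) as (d2 & Hd2 & K2); [lra|].
    destruct Lx0 as (b & y & z & Hx & S).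
    set (d3 := Rmin (b - x0) (x0 + b)).
    exists (Rmin (Rmin d1 d2) d3). split; [repeat apply Rmin_glb_lt; lra|].
    intros x c' Dx Hx' Dx' Ex.
    assert (A3 := Rlt_le_trans _ _ _ Hx' (Rmin_r _ _)).
    assert (A12 := Rlt_le_trans _ _ _ Hx' (Rmin_l _ _)).
    assert (A1 := Rlt_le_trans _ _ _ A12 (Rmin_l _ _)).
    assert (A2 := Rlt_le_trans _ _ _ A12 (Rmin_r _ _)).
    assert (B1 := Rlt_le_trans _ _ _ A3 (Rmin_l _ _)).
    assert (B2 := Rlt_le_trans _ _ _ A3 (Rmin_r _ _)).
    apply Rabs_def2 in B1. apply Rabs_def2 in B2.
    assert (Lx : leaf_domain M H c x) by (exists b, y, z; split; trivial; lra).
    apply (Conclude x c'); trivial. apply (sign_near a); trivial.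
    replace (G x - leaf_height M H c x - a)
      with ((G x - G x0) + - (leaf_height M H c x - leaf_height M H c x0)) by (unfold a; ring).
    eapply Rle_lt_trans; [apply Rabs_triang|]. rewrite Rabs_Ropp.
    assert (Q1 := K1 x Dx A1). assert (Q2 := K2 x Lx A2). lra.
  - destruct (leaf_domain_bounded M H c x0 (leaf_domain_start M H c HM Rg) Lx0) as (beta & Hb & Dom).
    destruct (leaf_end M H c beta HM Hb Dom) as (l & Hl & Nl).
    assert (Far : beta <= Rabs x0).
    { destruct (Rle_dec beta (Rabs x0)); trivial. exfalso. apply Lx0, Dom.
      assert (A : Rabs x0 < beta) by lra. apply Rabs_def2 in A. lra. }
    assert (Lb : forall c' x, beta <= Rabs x -> leaf_domain M H c' x -> leaf_domain M H c' beta).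
    { intros c' x Hx Dx. apply (leaf_domain_le M H c' x); trivial. now rewrite (Rabs_pos_eq beta) by lra. }
    assert (Db0 := Lb c0 x0 Far D0).
    assert (O0 := leaf_end_order M H c beta l c0 HM Dis Hb Dom Hl Nl Db0).
    assert (Beyond : forall x c', beta <= Rabs x -> leaf_domain M H c' x -> (c' - c) * (c0 - c) > 0).
    { intros x c' Hx Dx. assert (Db' := Lb c' x Hx Dx).
      assert (O := leaf_end_order M H c beta l c' HM Dis Hb Dom Hl Nl Db').
      assert (R0 : kruskal_region M (leaf_height M H c0 beta) beta)
        by now apply (leaf_trajectory M H c0 HM).
      assert (R' : kruskal_region M (leaf_height M H c' beta) beta)
        by now apply (leaf_trajectory M H c' HM).
      destruct (Rgt_dec ((c' - c) * (c0 - c)) 0) as [|h]; trivial. exfalso.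
      (* Otherwise the two leaves pass on either side of the end [l], and [l] is
         a regular height. *)
      apply Nl.
      destruct (Rle_dec (leaf_height M H c0 beta) l); destruct (Rle_dec (leaf_height M H c' beta) l).
      - nra.
      - apply (kruskal_region_convex M _ l _ beta R0 R'). lra.
      - apply (kruskal_region_convex M _ l _ beta R' R0). lra.
      - nra. }
    destruct Far as [Far|Far].
    + exists (Rabs x0 - beta). split; [lra|]. intros x c' _ Hx Dx _. apply (Beyond x); trivial.
      assert (A := Rabs_triang_inv x0 x). rewrite Rabs_minus_sym in A. lra.
    + set (a := leaf_height M H c0 beta - l) in *.
      assert (Ea : a = G x0 - l).
      { unfold a. rewrite <- E0, Far. unfold Rabs. destruct (Rcase_abs x0); trivial.
        now rewrite (proj2 (leaf_even M H c0 x0 HM D0)). }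
      assert (Pa : 0 < Rabs a).
      { apply Rabs_pos_lt. intros e. rewrite e, Rmult_0_l in O0. lra. }
      destruct (proj1 (continue_in_iff _ _ _) CG (Rabs a / 2)) as (d1 & Hd1 & K1); [lra|].
      exists (Rmin d1 (Rabs a / 2)). split; [apply Rmin_glb_lt; lra|].
      intros x c' Dx Hx Dx' Ex.
      assert (A1 := Rlt_le_trans _ _ _ Hx (Rmin_l _ _)).
      assert (A2 := Rlt_le_trans _ _ _ Hx (Rmin_r _ _)).
      destruct (Rle_dec beta (Rabs x)) as [h|h]; [now apply (Beyond x)|].
      assert (Hx3 : Rabs x < beta) by lra.
      assert (Lx : leaf_domain M H c x) by (apply Dom; apply Rabs_def2 in Hx3; lra).
      assert (Ll : Rabs (leaf_height M H c x - l) <= beta - Rabs x).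
      { assert (A := Hl (Rabs x) (conj (Rabs_pos x) Hx3)).
        replace (leaf_height M H c (Rabs x)) with (leaf_height M H c x) in A; trivial.
        unfold Rabs. destruct (Rcase_abs x); trivial.
        now rewrite (proj2 (leaf_even M H c x HM Lx)). }
      apply (Conclude x c'); trivial. apply (sign_near a); trivial.
      replace (G x - leaf_height M H c x - a)
        with ((G x - G x0) + - (leaf_height M H c x - l)) by (rewrite Ea; ring).
      eapply Rle_lt_trans; [apply Rabs_triang|]. rewrite Rabs_Ropp.
      assert (Q1 := K1 x Dx A1). assert (A := Rabs_triang_inv x0 x).
      rewrite Rabs_minus_sym in A. lra.
Qed.

Lemma derivative_at_maximum f d (D : R -> Prop) x0 del :
  0 < del -> (forall x, x0 - del <= x <= x0 + del -> D x) -> D_in f d D x0 ->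
  (forall x, x0 - del < x < x0 + del -> f x <= f x0) -> d x0 = 0.
Proof.
  intros Hd HD Df Max.
  assert (L : derivable_pt_lim f x0 (d x0)).
  { apply (D_in_interior f d D (x0 - del) (x0 + del)); trivial. lra. }
  assert (A := deriv_maximum f (x0 - del) (x0 + del) x0 (exist _ (d x0) L)).
  simpl in A. apply A; try lra. intros; apply Max; lra.
Qed.

(** At an extremum of the leaf index the curve touches the leaf from one side. *)
Lemma tangent_at_extremal_leaf M H (D : R -> Prop) G P c x1 del sg :
  0 < M -> leaves_disjoint M H -> trajectory M H D G P ->
  0 < del -> (forall x, x1 - del <= x <= x1 + del -> D x) ->
  leaf_domain M H c x1 -> leaf_height M H c x1 = G x1 -> sg <> 0 ->
  (forall x, D x -> exists c', leaf_domain M H c' x /\ leaf_height M H c' x = G x /\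
     sg * c' <= sg * c) ->
  P x1 = leaf_slope M H c x1.
Proof.
  intros HM Dis T Hd HD L1 E1 Hsg Ext.
  assert (LT := leaf_trajectory M H c HM).
  assert (D1 : D x1) by (apply HD; lra).
  assert (L1' := L1). destruct L1' as (b & y & z & Hb & S).
  set (d := Rmin del (Rmin (b - x1) (x1 + b) / 2)).
  assert (m0 : 0 < Rmin (b - x1) (x1 + b)) by (apply Rmin_glb_lt; lra).
  assert (d0 : 0 < d) by (apply Rmin_glb_lt; lra).
  assert (d1 : d <= del) by apply Rmin_l.
  assert (d2 : d <= Rmin (b - x1) (x1 + b) / 2) by apply Rmin_r.
  assert (m1 := Rmin_l (b - x1) (x1 + b)). assert (m2 := Rmin_r (b - x1) (x1 + b)).
  set (I := fun x => x1 - d <= x <= x1 + d).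
  assert (ID : forall x, I x -> D x) by (intros x Hx; unfold I in Hx; apply HD; lra).
  assert (IL : forall x, I x -> leaf_domain M H c x).
  { intros x Hx. unfold I in Hx. exists b, y, z. split; trivial. lra. }
  assert (Dif : D_in (fun x => sg * (G x - leaf_height M H c x))
                  (fun x => sg * (P x - leaf_slope M H c x)) I x1).
  { apply Dmult_const, Dminus.
    - apply (D_in_imp _ _ _ _ _ ID). now apply T.
    - apply (D_in_imp _ _ _ _ _ IL). now apply LT. }
  assert (Z := derivative_at_maximum _ _ I x1 d d0 (fun x Hx => Hx) Dif).
  cbv beta in Z. rewrite E1, Rminus_diag, Rmult_0_r in Z.
  assert (Z' : sg * (P x1 - leaf_slope M H c x1) = 0).
  { apply Z. intros x Hx. assert (Ix : I x) by (unfold I; lra).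
    destruct (Ext x (ID x Ix)) as (c' & Lx' & Ex' & Le).
    rewrite <- Ex'. destruct (Req_dec c' c) as [->|n]; [rewrite Rminus_diag; lra|].
    assert (O := leaf_order M H c' c x HM Dis Lx' (IL x Ix) n).
    destruct (Rle_dec 0 (leaf_height M H c' x - leaf_height M H c x)).
    - assert (c' - c > 0) by nra. nra.
    - assert (c' - c < 0) by nra. nra. }
  apply Rmult_integral in Z'. destruct Z'; [easy | lra].
Qed.

(** The leaf index of the solution has an interior extremum, where the solution
    is tangent to a leaf. *)
Lemma symmetric_boundary_in_leaf M H X0 G :
  0 < M -> leaves_cover M H -> leaves_disjoint M H -> 0 < X0 ->
  ss_cmc M H (closed_interval (- X0) X0) G -> G X0 = G (- X0) ->
  exists c, forall x, closed_interval (- X0) X0 x ->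
    leaf_domain M H c x /\ leaf_height M H c x = G x.
Proof.
  intros HM Cov Dis HX SG Bd. apply ss_cmc_iff in SG. destruct SG as ((CD & _) & P & T).
  set (D := closed_interval (- X0) X0) in *. set (cl := clamp (- X0) X0).
  assert (Dcl : forall x, D (cl x)) by (intros x; apply clamp_bounds; lra).
  assert (Idcl : forall x, D x -> cl x = x) by (intros x Hx; now apply clamp_id).
  set (index := fun x => epsilon (inhabits 0)
    (fun c => leaf_domain M H c (cl x) /\ leaf_height M H c (cl x) = G (cl x))).
  assert (Ix : forall x, leaf_domain M H (index x) (cl x) /\
                         leaf_height M H (index x) (cl x) = G (cl x)).
  { intros x. unfold index. apply epsilon_spec, Cov. now apply T. }
  assert (Ci : continuity index).
  { intros x. apply continuity_pt_iff. intros eps He.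
    assert (CG := trajectory_continue M H D G P (cl x) T (Dcl x)).
    destruct (Ix x) as (Lx & Ex).
    destruct (leaf_index_locally M H (index x + eps) (index x) D G (cl x))
      as (d1 & Hd1 & K1); trivial; [lra|].
    destruct (leaf_index_locally M H (index x - eps) (index x) D G (cl x))
      as (d2 & Hd2 & K2); trivial; [lra|].
    exists (Rmin d1 d2). split; [apply Rmin_glb_lt; lra|]. intros y Hy.
    assert (A1 := Rlt_le_trans _ _ _ Hy (Rmin_l _ _)).
    assert (A2 := Rlt_le_trans _ _ _ Hy (Rmin_r _ _)).
    assert (Lc := clamp_lipschitz (- X0) X0 y x). fold cl in Lc.
    destruct (Ix y) as (Ly & Ey).
    assert (B1 := K1 (cl y) (index y) (Dcl y) (Rle_lt_trans _ _ _ Lc A1) Ly Ey).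
    assert (B2 := K2 (cl y) (index y) (Dcl y) (Rle_lt_trans _ _ _ Lc A2) Ly Ey).
    apply Rabs_def1; nra. }
  assert (Ends : index (- X0) = index X0).
  { destruct (Ix X0) as (L1 & E1). destruct (Ix (- X0)) as (L2 & E2).
    rewrite Idcl in L1, E1, L2, E2 by (unfold D, closed_interval; lra).
    destruct (leaf_even M H _ _ HM L1) as (L3 & E3).
    apply (Dis _ _ (- X0)); trivial. congruence. }
  destruct (continuity_ab_maj index (- X0) X0) as (xM & HM1 & IM); [lra | auto|].
  destruct (continuity_ab_min index (- X0) X0) as (xm & Hm1 & Im); [lra | auto|].
  assert (Int : exists x1 sg, - X0 < x1 < X0 /\ sg <> 0 /\
            forall x, D x -> sg * index x <= sg * index x1).
  { destruct (classic (- X0 < xM < X0)) as [h|h].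
    { exists xM, 1. split; [trivial|]. split; [lra|]. intros x Hx. assert (A := HM1 x Hx). lra. }
    destruct (classic (- X0 < xm < X0)) as [h'|h'].
    { exists xm, (-1). split; [trivial|]. split; [lra|]. intros x Hx. assert (A := Hm1 x Hx). lra. }
    (* Both extrema lie at the ends: the index is constant. *)
    assert (EM : index xM = index X0).
    { assert (e : xM = X0 \/ xM = - X0) by (destruct (Req_dec xM X0); [left | right]; lra).
      destruct e as [-> | ->]; trivial. }
    assert (Em : index xm = index X0).
    { assert (e : xm = X0 \/ xm = - X0) by (destruct (Req_dec xm X0); [left | right]; lra).
      destruct e as [-> | ->]; trivial. }
    exists 0, 1. split; [lra|]. split; [lra|]. intros x Hx.
    assert (A := HM1 x Hx). assert (B := Hm1 0). lra. }
  destruct Int as (x1 & sg & Hx1 & Hsg & Ext).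
  assert (D1 : D x1) by (unfold D, closed_interval; lra).
  destruct (Ix x1) as (L1 & E1). rewrite (Idcl x1 D1) in L1, E1.
  assert (Tg : P x1 = leaf_slope M H (index x1) x1).
  { apply (tangent_at_extremal_leaf M H D G P (index x1) x1
             (Rmin (X0 - x1) (x1 + X0)) sg); trivial.
    - apply Rmin_glb_lt; lra.
    - intros x Hx. assert (A := Rmin_l (X0 - x1) (x1 + X0)).
      assert (B := Rmin_r (X0 - x1) (x1 + X0)). unfold D, closed_interval. lra.
    - intros x Hx. exists (index x). destruct (Ix x) as (Lx & Ex).
      rewrite (Idcl x Hx) in Lx, Ex. auto. }
  exists (index x1). intros x Hx.
  destruct (tangent_solution_in_leaf M H (index x1) D G P x1 x) as (Lx & Ex); auto.
Qed.

Lemma foliation_imp_dirichlet M H : 0 < M ->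
  leaves_cover M H -> leaves_disjoint M H -> dirichlet_solvable M H.
Proof.
  intros HM Cov Dis T0 X0 HX Rg _.
  destruct (Cov T0 X0 Rg) as (c & L & E). destruct (leaf_even M H c X0 HM L) as (_ & Ev).
  exists (leaf_height M H c). split; [split; [now apply leaf_ss_cmc_closed | lra]|].
  intros G SG G1 G2.
  destruct (symmetric_boundary_in_leaf M H X0 G) as (c' & Hc'); trivial; [lra|].
  destruct (Hc' X0) as (L' & E'); [unfold closed_interval; lra|].
  assert (c' = c) as -> by (apply (Dis c' c X0); trivial; lra).
  intros x Hx. symmetry. now apply Hc'.
Qed.

Theorem theorem12 (M H : R) (HM : 0 < M) :
  (forall T0 X0 : R,
     0 < X0 -> kruskal_region M T0 X0 -> kruskal_region M T0 (- X0) ->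
     exists F : R -> R,
       (ss_cmc M H (closed_interval (- X0) X0) F /\
        F X0 = T0 /\ F (- X0) = T0) /\
       (forall G : R -> R,
          ss_cmc M H (closed_interval (- X0) X0) G ->
          G X0 = T0 -> G (- X0) = T0 ->
          forall x, closed_interval (- X0) X0 x -> G x = F x))
  <->
  foliates (tss_cmc_family M H) (kruskal_extension M).
Proof.
  rewrite foliates_iff by trivial. split.
  - exact (dirichlet_imp_foliation M H HM).
  - intros (Cov & Dis). exact (foliation_imp_dirichlet M H HM Cov Dis).
Qed.
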